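(* Let $k, n$ be nonnegative integers. Let $p_1, \dots, p_{k+1}$ be primes (not necessarily distinct) such that, for each $1 \leq i \leq k+1$, $p_i \equiv 1 \pmod{24}$ and $\overline{\mathcal{EO}}\left(\frac{19p_i-1}{3}\right) \equiv 0 \pmod{8}$. Then for any integer $j \not\equiv 0 \pmod{p_{k+1}}$, $$\overline{\mathcal{EO}}\left(8p_1^2\cdots p_{k+1}^2\, n + \frac{p_1^2\cdots p_{k}^2\, p_{k+1}(24j+19p_{k+1})-1}{3}\right) \equiv 0 \pmod 8,$$ where the empty product $p_1^2\cdots p_k^2$ for $k=0$ is $1$.
   Context: For a nonnegative integer $n$, $\mathcal{EO}(n)$ is the number of partitions of $n$ in which every even part is less than each odd part. $\overline{\mathcal{EO}}(n)$ is the number of partitions counted by $\mathcal{EO}(n)$ in which only the largest even part appears an odd number of times (that is, if the partition has an even part, then the largest even part appears an odd number of times and every other part size that occurs appears an even number of times; if there are no even parts, every part size that occurs appears an even number of times). For example $\overline{\mathcal{EO}}(8)=5$, the relevant partitions being $8$, $4+2+2$, $3+3+2$, $3+3+1+1$, $1+1+1+1+1+1+1+1$. Equivalently (Andrews), $\overline{\mathcal{EO}}(n)$ is given by the generating function $$\sum_{n=0}^{\infty}\overline{\mathcal{EO}}(n)q^n=\frac{(q^4; q^4)_{\infty}^3}{(q^2; q^2)_{\infty}^2},\qquad (a; q)_{\infty}:=\prod_{m\geq 0}(1-aq^m).$$ By convention $\overline{\mathcal{EO}}(m)=0$ for negative integers $m$. *)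

(* Defs.v *)
From mathcomp Require Import all_boot all_order all_algebra.
Set Implicit Arguments.
Unset Strict Implicit.
Unset Printing Implicit Defensive.

(* A partition of n is encoded by its multiplicities: m a is the number of
   occurrences of the part a. Both a and m a are at most n. *)
Definition multiplicities (n : nat) := {ffun 'I_n.+1 -> 'I_n.+1}.

Definition is_partition n (m : multiplicities n) : bool :=
  (m ord0 == 0 :> nat) && (\sum_(a < n.+1) a * m a == n).

Definition is_part n (m : multiplicities n) (a : 'I_n.+1) : bool := 0 < m a.

Definition evens_below_odds n (m : multiplicities n) : bool :=
  [forall a, forall b,
    [&& is_part m a, is_part m b, ~~ odd a & odd b] ==> (a < b)].

Definition largest_even_part n (m : multiplicities n) (a : 'I_n.+1) : bool :=
  [&& is_part m a, ~~ odd a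
    & [forall b, is_part m b && ~~ odd b ==> (b <= a)]].

Definition EO_partition n (m : multiplicities n) : bool :=
  is_partition m && evens_below_odds m.

Definition EObar_partition n (m : multiplicities n) : bool :=
  EO_partition m &&
  [forall a, is_part m a ==> (odd (m a) == largest_even_part m a)].

Definition EObar_nat (n : nat) : nat :=
  #|[set m : multiplicities n | EObar_partition m]|.

Definition EObar (z : int) : nat :=
  if z is Posz n then EObar_nat n else 0.

(* Main.v *)
Require Import Defs.
From mathcomp Require Import all_boot all_order all_algebra.
From mathcomp Require Import all_fingroup all_solvable all_field.
From mathcomp Require Import zify ring.

(** Write f_k = (y^k; y^k)_oo (this is [euler] at y^k), phi(y) = sum over all
    integers n of y^(n^2), and psi(y) = sum over l >= 0 of y^(l(l+1)/2).

    Generating function. The partitions counted by EObar, sorted by their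
    largest even part 2j, satisfy one condition per part size, so each class has
    a product as generating function. The sum of these products over j is an
    instance of the q-binomial theorem, and with y = q^2 it gives
    sum_m EObar(2m) y^m = (y^2; y^2)_oo / (y; y^2)_oo^2 (lemmas [EObar_coef]
    and [EO_gf_prod]).

    Extraction modulo 8. Rearranging products turns the right-hand side into
    f_4 phi(y) phi(y^2) / phi(-y^4)^2, and phi(y) = phi(y^4) + 2 y psi(y^8), so
    the exponents 3 mod 4 carry a factor 4: EObar(8m+6) is four times the
    coefficient of y^m in f_1 psi(y^2) psi(y^4) / phi(-y)^2 ([EO_gf_coef]).
    Modulo 2 one has phi = 1, psi = f_1^3 and f_2 = f_1^2, hence this series is
    f_1^19 = f_16 psi ([ternary_to_binary]). With the pentagonal number theorem,
    its coefficient at y^m has the parity of the number of pairs (X, Y) of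
    natural numbers with X odd and 16 X^2 + 3 Y^2 = 24 m + 19 ([EObar_reps]).

    Parity of the number of pairs. Let M = 24 m + 19 and let p = 1 mod 24 be a
    prime with p^e exactly dividing M, e > 0. In Z[sqrt(-3)] the prime p splits
    as pi * conj pi with pi = u + 4 w sqrt(-3). A pair (X, Y) is an
    element 4 X + Y sqrt(-3) of norm M up to signs, and if p does not divide X,
    then exactly one of pi^e, (conj pi)^e divides it. Exchanging these two
    factors pairs off the solutions, without fixed points
    ([even_primitive_reps]). The remaining solutions are p times the solutions
    for M / p^2. Descending, the number of pairs is even as soon as p divides M
    to an odd power ([even_reps]). In the theorem
    M = p_1^2 ... p_k^2 * q * t with q = p_(k+1) and q not dividing t.

    Power series are handled modulo x^N, as elements of a commutative ring in
    which x^N = 0: there infinite products and sums are finite. The ring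
    A[X]/(X^N) transports the resulting identities to coefficients. *)

Set Implicit Arguments.
Unset Strict Implicit.
Unset Printing Implicit Defensive.
Import GRing.Theory Num.Theory.
Local Open Scope ring_scope.

(** * Products and theta series at a nilpotent argument *)

Section QSeries.
Variable R : comNzRingType.
Implicit Types (a b u v w x y z : R).

Lemma nilp_le x N M : x ^+ N = 0 -> (N <= M)%N -> x ^+ M = 0.
Proof. by move=> xN le; rewrite -(subnK le) exprD xN mulr0. Qed.

Lemma nilpX x N k : x ^+ N = 0 -> (0 < k)%N -> (x ^+ k) ^+ N = 0.
Proof. by move=> xN k0; rewrite -exprM mulnC exprM xN expr0n; case: k k0. Qed.

Lemma lreg_left_inverse a b : b * a = 1 -> GRing.lreg a.
Proof.
by move=> ba x y /(congr1 ( *%R b)); rewrite !mulrA ba !mul1r.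
Qed.

Lemma nilp_unit y N : y ^+ N = 0 -> (1 - y) * \sum_(i < N) y ^+ i = 1.
Proof.
by move=> yN; have := subrX1 y N; rewrite yN => e; rewrite -opprB mulNr -e; ring.
Qed.

(** The finite product (a; z)_n. Once z^N = 0 and n >= N, it no longer depends
    on n and stands for (a; z)_oo. *)
Definition qpoch a z n : R := \prod_(i < n) (1 - a * z ^+ i).

Lemma qpochS a z n : qpoch a z n.+1 = qpoch a z n * (1 - a * z ^+ n).
Proof. by rewrite /qpoch big_ord_recr. Qed.

Lemma qpoch_stable a z N n : z ^+ N = 0 -> (N <= n)%N ->
  qpoch a z n = qpoch a z N.
Proof.
move=> zN; elim: n => [|n IH]; first by rewrite leqn0 => /eqP->.
rewrite leq_eqVlt => /predU1P[->//|le]; rewrite qpochS IH //.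
by rewrite (nilp_le zN le) mulr0 subr0 mulr1.
Qed.

(** The factors 1 - a z^i are units when a is nilpotent, so these products can be
    cancelled although the ring has zero divisors. *)
Lemma qpoch_lreg a z N n : a ^+ N = 0 -> GRing.lreg (qpoch a z n).
Proof.
move=> aN; elim: n => [|n IH]; first by rewrite /qpoch big_ord0; apply: lreg1.
rewrite qpochS; apply: lregM => //.
apply: (@lreg_left_inverse _ (\sum_(i < N) (a * z ^+ n) ^+ i)).
by rewrite mulrC nilp_unit // exprMn aN mul0r.
Qed.

Lemma qpoch_pm a z n : qpoch a z n * qpoch (- a) z n = qpoch (a ^+ 2) (z ^+ 2) n.
Proof.
rewrite -big_split; apply: eq_bigr => i _ /=.
by rewrite -exprM mulnC exprM; ring.
Qed.

Lemma qpoch_split2 a z n :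
  qpoch a z (n + n) = qpoch a (z ^+ 2) n * qpoch (a * z) (z ^+ 2) n.
Proof.
elim: n => [|n IH]; first by rewrite /qpoch !big_ord0 mulr1.
by rewrite addnS addSn !qpochS IH -!exprM mul2n -addnn [z ^+ (n + n).+1]exprS; ring.
Qed.

Lemma qpoch_split3 a z n : qpoch a z (n + n + n) =
  qpoch a (z ^+ 3) n * qpoch (a * z) (z ^+ 3) n * qpoch (a * z ^+ 2) (z ^+ 3) n.
Proof.
elim: n => [|n IH]; first by rewrite /qpoch !big_ord0 !mulr1.
rewrite !addnS !addSn !qpochS IH -!exprM.
have -> : (3 * n = n + n + n)%N by lia.
rewrite [z ^+ (n + n + n).+2]exprS [z ^+ (n + n + n).+1]exprS; ring.
Qed.

(** The q-binomial theorem, with c j = (a; w)_j / (w; w)_j given by its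
    recurrence. The sum F(z) satisfies (1 - z) F(z) = (1 - a z) F(w z); iterating
    N times replaces the argument z by w^N z = 0. *)
Lemma qbinomial (c : nat -> R) a z w N : z ^+ N = 0 -> w ^+ N = 0 -> c 0%N = 1 ->
  (forall j, c j.+1 * (1 - w ^+ j.+1) = c j * (1 - a * w ^+ j)) ->
  qpoch z w N * (\sum_(j < N) c j * z ^+ j) = qpoch (a * z) w N.
Proof.
move=> zN wN c0 cS.
case: N zN wN => [|N] zN wN; first by case/eqP: (oner_neq0 R); rewrite -(expr0 z).
pose F y := \sum_(j < N.+1) c j * y ^+ j.
have FE y : y ^+ N.+1 = 0 -> (1 - y) * F y = (1 - a * y) * F (w * y).
  move=> yN.
  have E1 : F y - F (w * y) = \sum_(j < N) c j * (1 - a * w ^+ j) * y ^+ j.+1.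
    rewrite /F -sumrB big_ord_recl expr0 expr0 subrr add0r.
    by apply: eq_bigr => i _; rewrite -cS exprMn !lift0; ring.
  have E2 : y * (F y - a * F (w * y)) =
      \sum_(j < N) c j * (1 - a * w ^+ j) * y ^+ j.+1.
    rewrite /F mulr_sumr -sumrB mulr_sumr big_ord_recr /= [X in _ + X](_ : _ = 0).
      by rewrite addr0; apply: eq_bigr => i _; rewrite exprMn exprS; ring.
    transitivity (y ^+ N.+1 * (c N * (1 - a * w ^+ N))).
      by rewrite exprMn exprS; ring.
    by rewrite yN mul0r.
  have := etrans E1 (esym E2) => e.
  apply/eqP; rewrite -subr_eq0; apply/eqP.
  by move/eqP: e; rewrite -subr_eq0 => /eqP e; rewrite -[RHS]e; ring.
have it n : qpoch z w n * F z = qpoch (a * z) w n * F (w ^+ n * z).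
  elim: n => [|n IH]; first by rewrite /qpoch !big_ord0 expr0 !mul1r.
  rewrite !qpochS mulrAC IH.
  transitivity (qpoch (a * z) w n * ((1 - w ^+ n * z) * F (w ^+ n * z))).
    by ring.
  rewrite FE; last by rewrite exprMn zN mulr0.
  have -> : w * (w ^+ n * z) = w ^+ n.+1 * z by rewrite exprS mulrA.
  ring.
rewrite it wN mul0r /F big_ord_recl big1 => [|i _]; last by rewrite lift0 exprS mul0r mulr0.
by rewrite c0 expr0 addr0 !mulr1.
Qed.

(** Gaussian binomial coefficients, defined by one of the two Pascal rules so
    that no division is involved; [gbinS_left] is the other rule. *)
Fixpoint gbin w (m j : nat) : R :=
  match m, j with
  | _, 0 => 1
  | 0, _.+1 => 0
  | m'.+1, j'.+1 => gbin w m' j + w ^+ (m' - j') * gbin w m' j'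
  end.

Arguments gbin : simpl never.

Lemma gbin0 w m : gbin w m 0 = 1. Proof. by case: m. Qed.

Lemma gbinS w m j :
  gbin w m.+1 j.+1 = gbin w m j.+1 + w ^+ (m - j) * gbin w m j.
Proof. by []. Qed.

Lemma gbin_small w m j : (m < j)%N -> gbin w m j = 0.
Proof.
elim: m j => [|m IH] [|j] //; rewrite ltnS => lt.
by rewrite gbinS !IH ?mulr0 ?addr0 // ltnW.
Qed.

(** The ratio of consecutive coefficients, which is also exactly the difference
    between the two Pascal rules. *)
Lemma gbin_step w m j :
  (1 - w ^+ j.+1) * gbin w m j.+1 = (1 - w ^+ (m - j)) * gbin w m j.
Proof.
elim: m j => [|m IH] j; first by rewrite sub0n subrr mul0r mulr0.
have top i : (1 - w ^+ i.+1) * gbin w m.+1 i.+1 = (1 - w ^+ m.+1) * gbin w m i.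
  have [lt|le] := ltnP m i.
    by rewrite !gbin_small ?mulr0 // ltnS.
  have -> : w ^+ m.+1 = w ^+ i.+1 * w ^+ (m - i) by rewrite -exprD; congr (_ ^+ _); lia.
  by rewrite gbinS mulrDr IH; ring.
rewrite top; case: j => [|j]; first by rewrite !gbin0 subn0.
have [lt|le] := ltnP m j.
  by rewrite !gbin_small ?mulr0 // ltnW.
rewrite subSS gbinS mulrDr [X in _ = _ + X]mulrCA -IH.
have -> : w ^+ m.+1 = w ^+ j.+1 * w ^+ (m - j) by rewrite -exprD; congr (_ ^+ _); lia.
ring.
Qed.

Lemma gbinS_left w m j :
  gbin w m.+1 j.+1 = w ^+ j.+1 * gbin w m j.+1 + gbin w m j.
Proof.
have e := gbin_step w m j; rewrite gbinS; apply/eqP; rewrite -subr_eq0.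
by move/eqP: e; rewrite -subr_eq0 => /eqP e; apply/eqP; rewrite -[RHS]e; ring.
Qed.

Lemma gbin_qpoch w m j : (j <= m)%N ->
  gbin w m j * (qpoch w w j * qpoch w w (m - j)) = qpoch w w m.
Proof.
elim: m j => [|m IH] [|j] le; rewrite ?gbin0 ?subn0 ?[qpoch w w 0]big_ord0 ?mul1r //.
rewrite gbinS subSS mulrDl.
have -> : w ^+ (m - j) * gbin w m j * (qpoch w w j.+1 * qpoch w w (m - j)) =
   w ^+ (m - j) * (1 - w ^+ j.+1) * qpoch w w m.
  by rewrite -(IH j) // qpochS exprS; ring.
rewrite [in RHS]qpochS -exprS.
move: le; rewrite ltnS leq_eqVlt => /predU1P[->|lt].
  by rewrite subnn gbin_small // mul0r add0r expr0; ring.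
have -> : gbin w m j.+1 * (qpoch w w j.+1 * qpoch w w (m - j)) =
    (1 - w ^+ (m - j)) * qpoch w w m.
  by rewrite -(IH j.+1) // -(subnSK lt) [qpoch w w (m - _).+1]qpochS [in RHS]exprS; ring.
have -> : w ^+ m.+1 = w ^+ j.+1 * w ^+ (m - j) by rewrite -exprD; congr (_ ^+ _); lia.
ring.
Qed.

(** The term u^(k(k+1)/2) v^(k(k-1)/2) of the Jacobi triple product at the integer
    k = j - n. The shift by n keeps the index natural, and the two branches
    describe the signs of k. *)
Definition jterm u v (n j : nat) : R :=
  if (n <= j)%N then u ^+ 'C((j - n).+1, 2) * v ^+ 'C(j - n, 2)
  else u ^+ 'C(n - j, 2) * v ^+ 'C((n - j).+1, 2).

Lemma jterm_ge u v n d : jterm u v n (n + d) = u ^+ 'C(d.+1, 2) * v ^+ 'C(d, 2).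
Proof. by rewrite /jterm leq_addr addKn. Qed.

Lemma jterm_le u v j d : jterm u v (d + j) j = u ^+ 'C(d, 2) * v ^+ 'C(d.+1, 2).
Proof.
rewrite /jterm addnK; case: d => [|d]; first by rewrite leqnn subnn.
by rewrite leqNgt addSn ltnS leq_addl.
Qed.

(** Multiplication by u w^n or v w^n, w = u v, moves k to k + 1 or k - 1; the
    surplus power of w is the one required by the Pascal rules. *)
Lemma jterm_up u v n j : (j <= n + n)%N ->
  u * (u * v) ^+ n * jterm u v n j = (u * v) ^+ (n + n - j) * jterm u v n j.+1.
Proof.
have [le|lt] := leqP n j => le2.
  have [d ? ?] : exists2 d, j = (n + d)%N & (d <= n)%N by exists (j - n)%N; lia.
  subst j; rewrite -addnS !jterm_ge subnDl !binS !bin1 ?bin0 !exprD.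
  have [e ?] : exists e, n = (e + d)%N by exists (n - d)%N; lia.
  by subst n; rewrite addnK exprD !exprS !exprMn; ring.
have [d ?] : exists d, n = (d.+1 + j)%N by exists (n - j).-1; lia.
subst n; rewrite jterm_le addSn -addnS jterm_le !binS !bin1 ?bin0.
have -> : (d + j.+1 + (d + j.+1) - j = d.+1 + (d + j.+1))%N by lia.
rewrite !exprD ?exprS !exprMn; ring.
Qed.

Lemma jterm_down u v n j : (j <= n + n)%N ->
  v * (u * v) ^+ n * jterm u v n j.+1 = (u * v) ^+ j.+1 * jterm u v n j.
Proof.
have [le|lt] := leqP n j => le2.
  have [d ?] : exists d, j = (n + d)%N by exists (j - n)%N; lia.
  subst j; rewrite -addnS !jterm_ge !binS !bin1 ?bin0 !exprD ?exprS !exprMn; ring.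
have [d ?] : exists d, n = (d.+1 + j)%N by exists (n - j).-1; lia.
subst n; rewrite jterm_le addSn -addnS jterm_le !binS !bin1 ?bin0.
rewrite !exprD ?exprS !exprMn; ring.
Qed.

(** Finite form of the Jacobi triple product, by induction on n: the factor
    1 + u w^n is absorbed by the first Pascal rule and 1 + v w^n by the second. *)
Lemma finite_jacobi u v n :
  \prod_(i < n) ((1 + u * (u * v) ^+ i) * (1 + v * (u * v) ^+ i)) =
  \sum_(j < (n + n).+1) gbin (u * v) (n + n) j * jterm u v n j.
Proof.
set w := u * v; elim: n => [|n IH].
  by rewrite big_ord0 big_ord1 /jterm /= !expr0 !mulr1.
rewrite big_ord_recr /= IH mulrA.
have -> : (\sum_(j < (n + n).+1) gbin w (n + n) j * jterm u v n j) *
     (1 + u * w ^+ n) =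
   \sum_(j < (n + n).+2) gbin w (n + n).+1 j * jterm u v n j.
  rewrite mulrDr mulr1 [in RHS]big_ord_recl gbin0 mul1r.
  under [in RHS]eq_bigr do rewrite lift0 gbinS mulrDl.
  rewrite big_split /= addrA; congr (_ + _).
    rewrite big_ord_recl gbin0 mul1r; congr (_ + _).
    rewrite [in RHS]big_ord_recr /= gbin_small // mul0r addr0.
    by apply: eq_bigr => i _; rewrite ?lift0.
  rewrite mulr_suml; apply: eq_bigr => i _.
  rewrite -mulrA [_ * (u * _)]mulrC jterm_up; last by rewrite -ltnS.
  by ring.
rewrite addSn addnS mulrDr mulr1.
have J i : jterm u v n.+1 i.+1 = jterm u v n i by rewrite /jterm ltnS !subSS.
rewrite [in RHS]big_ord_recl gbin0 mul1r.
under [in RHS]eq_bigr do rewrite lift0 J gbinS_left mulrDl.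
rewrite big_split /= addrA addrC; congr (_ + _).
rewrite mulr_suml big_ord_recl gbin0 mul1r; congr (_ + _).
  have := jterm_le u v 0 n; rewrite addn0 => ->.
  have := jterm_le u v 0 n.+1; rewrite addn0 => ->.
  by rewrite !binS !bin1 ?bin0 /w !exprD !exprMn; ring.
rewrite [in RHS]big_ord_recr /= gbin_small // mulr0 mul0r addr0.
apply: eq_bigr => i _; rewrite ?lift0 -mulrA [_ * (v * _)]mulrC jterm_down.
  by ring.
by rewrite -ltnS.
Qed.

(** Ramanujan's f(u, v), the sum of u^(k(k+1)/2) v^(k(k-1)/2) over all integers
    k, where the summand collects k and -(k+1). *)
Definition theta u v N : R :=
  \sum_(k < N) u ^+ 'C(k.+1, 2) * (v ^+ 'C(k, 2) + v ^+ 'C(k.+2, 2)).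

Lemma bin2_ge k : (k <= 'C(k.+1, 2))%N.
Proof. by rewrite binS bin1 leq_addl. Qed.

Lemma big_ord_trunc (F : nat -> R) N M : (N <= M)%N ->
  (forall k, (N <= k < M)%N -> F k = 0) -> \sum_(k < M) F k = \sum_(k < N) F k.
Proof.
move=> le F0; rewrite -(subnKC le) big_split_ord /= [X in _ + X]big1 ?addr0 // => i _.
by apply: F0; rewrite leq_addr -ltn_subRL ltn_ord.
Qed.

(** In the finite form with n = 2N, every term with |k| >= N vanishes, and for the
    others the Gaussian binomial times (w; w)_oo is 1, since all three products
    in [gbin_qpoch] have stabilised. *)
Lemma jacobi_triple u v N : u ^+ N = 0 -> v ^+ N = 0 ->
  qpoch (- u) (u * v) N * qpoch (- v) (u * v) N * qpoch (u * v) (u * v) N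
  = theta u v N.
Proof.
move=> uN vN; set w := u * v.
have wN : w ^+ N = 0 by rewrite exprMn uN mul0r.
set f := qpoch w w N; pose n := (N + N)%N.
have reg : GRing.lreg f by apply: qpoch_lreg wN.
have -> : qpoch (- u) w N * qpoch (- v) w N =
    \sum_(j < (n + n).+1) gbin w (n + n) j * jterm u v n j.
  rewrite -finite_jacobi -(@qpoch_stable (- u) w N n) ?leq_addr //.
  rewrite -(@qpoch_stable (- v) w N n) ?leq_addr // -big_split.
  by apply: eq_bigr => i _ /=; rewrite !mulNr !opprK.
have Tge d : (N <= d)%N -> jterm u v n (n + d) = 0.
  by move=> le; rewrite jterm_ge (nilp_le uN) ?mul0r // (leq_trans le) ?bin2_ge.
have mid j : (N <= j)%N -> (j <= n + n - N)%N -> gbin w (n + n) j * f = 1.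
  move=> j1 j2; apply: reg; rewrite mulr1.
  have := @gbin_qpoch w (n + n) j.
  rewrite !(@qpoch_stable w w N) //; [|lia..].
  by rewrite -/f => e; rewrite -[RHS]e; [ring|lia].
have Tle j : (j < N)%N -> jterm u v n j = 0.
  move=> lt; have [d E] : exists d, n = (d + j)%N by exists (n - j)%N; lia.
  rewrite E jterm_le (nilp_le vN) ?mulr0 // (leq_trans _ (bin2_ge d)) //.
  by move: E lt; rewrite /n; lia.
transitivity (\sum_(j < (n + n).+1) jterm u v n j).
  rewrite mulr_suml; apply: eq_bigr => [[j jlt]] _ /=.
  have [lt|ge] := ltnP j N; first by rewrite Tle // mulr0 mul0r.
  have [le|gt] := leqP j (n + n - N); first by rewrite mulrAC mid // mul1r.
  have -> : j = (n + (j - n))%N by move: gt; rewrite /n; lia.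
  by rewrite Tge ?mulr0 ?mul0r //; move: gt; rewrite /n; lia.
rewrite -addnS big_split_ord /= addrC.
rewrite (@big_ord_trunc (fun i => jterm u v n (n + i)) N); [|by rewrite /n; lia|by move=> k /andP[/Tge]].
  rewrite [X in _ + X](reindex_inj rev_ord_inj) /=.
  rewrite (@big_ord_trunc (fun i => jterm u v n (n - i.+1)) N) ?leq_addr //.
    rewrite -big_split; apply: eq_bigr => [[k kN]] _ /=.
    rewrite jterm_ge mulrDr; congr (_ + _).
    have [e E] : exists e, n = (k.+1 + e)%N by exists (n - k.+1)%N; rewrite /n; lia.
    by rewrite {2}E addKn E jterm_le.
  move=> k /andP[le lt].
  have [e E] : exists e, n = (k.+1 + e)%N by exists (n - k.+1)%N; lia.
  rewrite {2}E addKn E jterm_le (nilp_le vN) ?mulr0 //.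
  by rewrite (leq_trans _ (bin2_ge _)) // ltnW.
Qed.
End QSeries.

(** * The theta functions phi and psi *)

Section Theta.
Variable R : comNzRingType.
Implicit Types (x y z : R) (N : nat).

Definition euler z N : R := qpoch z z N.
Definition phi x N : R := theta x x N.
Definition psi x N : R := \sum_(l < N) x ^+ 'C(l.+1, 2).

Lemma euler_split x N : x ^+ N = 0 ->
  euler x N = qpoch x (x ^+ 2) N * euler (x ^+ 2) N.
Proof.
by move=> xN; rewrite /euler -(@qpoch_stable _ _ _ N (N + N)) ?leq_addr // qpoch_split2.
Qed.

Lemma phi_prod x N : x ^+ N = 0 ->
  phi x N = qpoch (- x) (x ^+ 2) N ^+ 2 * euler (x ^+ 2) N.
Proof. by move=> xN; rewrite /phi -jacobi_triple. Qed.

Lemma big_double (F : nat -> R) n :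
  \sum_(k < n + n) F k = \sum_(i < n) (F i.*2 + F i.*2.+1).
Proof.
elim: n => [|n IH]; first by rewrite !big_ord0.
by rewrite addnS addSn !big_ord_recr /= IH -addnn addrA.
Qed.

Lemma mul2_bin2 k : (2 * 'C(k.+1, 2) = k * k.+1)%N.
Proof. by elim: k => // k IH; rewrite binS bin1; lia. Qed.

Lemma phiE x N : phi x N = \sum_(k < N) (x ^+ (k ^ 2) + x ^+ (k.+1 ^ 2)).
Proof.
apply: eq_bigr => i _; rewrite mulrDr -!exprD; congr (_ ^+ _ + _ ^+ _).
  by have := mul2_bin2 i; rewrite binS bin1 -?mulnn -?muln2; lia.
by have := mul2_bin2 i; rewrite [in 'C(i.+2, _)]binS bin1 -?mulnn -?muln2; lia.
Qed.

(** Even squares are 4 i^2 and odd squares are 8 (i(i+1)/2) + 1. *)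
Lemma phi_dissect x N : x ^+ N = 0 ->
  phi x N = phi (x ^+ 4) N + (x * psi (x ^+ 8) N) *+ 2.
Proof.
move=> xN; rewrite !phiE /psi.
have tr (F : nat -> nat) : (forall k, (k <= F k)%N) ->
    \sum_(k < N + N) x ^+ F k = \sum_(k < N) x ^+ F k.
  move=> le; apply: (@big_ord_trunc _ (fun k => x ^+ F k)); rewrite ?leq_addr // => k /andP[Nk _].
  by apply: nilp_le xN (leq_trans Nk (le k)).
rewrite big_split /= -(tr (fun k => k ^ 2)%N); last by case=> // k; rewrite -mulnn leq_pmulr.
rewrite -(tr (fun k => k.+1 ^ 2)%N); last by move=> k; rewrite (leq_trans (leqnSn k)) // -mulnn leq_pmulr.
rewrite (@big_double (fun k => x ^+ (k ^ 2))) (@big_double (fun k => x ^+ (k.+1 ^ 2))).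
rewrite mulr_sumr -sumrMnl -!big_split; apply: eq_bigr => i _ /=.
rewrite -!exprM -exprS.
have -> : (i.*2 ^ 2 = 4 * i ^ 2)%N by rewrite -!mulnn -!muln2; lia.
have -> : (i.*2.+2 ^ 2 = 4 * i.+1 ^ 2)%N by rewrite -!mulnn -!muln2; lia.
have -> : (i.*2.+1 ^ 2 = (8 * 'C(i.+1, 2)).+1)%N by have := mul2_bin2 i; rewrite -mulnn -muln2; lia.
ring.
Qed.

(** The triangular numbers of odd and of even index are the exponents of the two
    halves of f(x^3, x). *)
Lemma psi_theta x N : x ^+ N = 0 -> psi x N = theta (x ^+ 3) x N.
Proof.
move=> xN; rewrite /psi.
rewrite -(@big_ord_trunc _ (fun k => x ^+ 'C(k.+1, 2)) N (N + N)) ?leq_addr //.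
  rewrite (@big_double (fun k => x ^+ 'C(k.+1, 2))); apply: eq_bigr => i _.
  rewrite mulrDr -!exprM -!exprD; congr (_ ^+ _ + _ ^+ _).
    by have := mul2_bin2 i; have := mul2_bin2 i.*2; rewrite [in 'C(i.+1, _)]binS bin1 -?mulnn -?muln2; lia.
  have := mul2_bin2 i; have := mul2_bin2 i.*2.+1.
  by rewrite [in 'C(i.+2, _)]binS bin1 -?mulnn -?muln2; lia.
move=> k /andP[le _]; apply: nilp_le xN (leq_trans le (bin2_ge k)).
Qed.

(** With o_k = (y^k; y^(2k))_oo, the relations f_k = o_k f_2k and
    o_k * (-y^k; y^(2k))_oo = o_2k reduce both sides, multiplied by o_1^2, to
    the same monomial. *)
Lemma EO_product_dissect (A y : R) N : y ^+ N = 0 ->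
  A * qpoch y (y ^+ 2) N ^+ 2 = euler (y ^+ 2) N ->
  A * phi (- y ^+ 4) N ^+ 2 = euler (y ^+ 4) N * phi y N * phi (y ^+ 2) N.
Proof.
move=> yN AE.
have nilp2 z : z ^+ N = 0 -> (z ^+ 2) ^+ N = 0 by move=> zN; apply: nilpX.
have y2N := nilp2 _ yN; have y4N := nilp2 _ y2N.
have e4 : y ^+ 4 = (y ^+ 2) ^+ 2 by rewrite -exprM.
have negN : (- y ^+ 4) ^+ N = 0 by rewrite exprNn e4 y4N mulr0.
have reg : GRing.lreg (qpoch y (y ^+ 2) N ^+ 2).
  by rewrite expr2; apply: lregM; apply: qpoch_lreg yN.
apply: reg; rewrite mulrA [_ * A]mulrC AE.
rewrite (phi_prod negN) (phi_prod yN) (phi_prod y2N) opprK sqrrN e4.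
have E2 := euler_split y2N; have E4 := euler_split y4N.
have := qpoch_pm y (y ^+ 2) N; have := qpoch_pm (y ^+ 2) ((y ^+ 2) ^+ 2) N.
rewrite E2 E4.
move: (qpoch y _ _) (qpoch (- y) _ _) (qpoch (y ^+ 2) _ _) (qpoch (- y ^+ 2) _ _).
move: (qpoch _ _ _) (euler _ _) => a b c d e f <- <-.
by ring.
Qed.

Lemma phi_sum x N : x ^+ N = 0 ->
  phi x N = 1 + (\sum_(k < N) x ^+ (k ^ 2) - 1) *+ 2.
Proof.
move=> xN; rewrite phiE; case: N xN => [|N] xN.
  by case/eqP: (oner_neq0 R); rewrite -(expr0 x).
rewrite big_split /= [X in _ + X]big_ord_recr [X in X + _]big_ord_recl [in RHS]big_ord_recl /=.
rewrite (@nilp_le _ x N.+1 (N.+1 ^ 2)) //; last by rewrite -mulnn leq_pmulr.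
have -> : \sum_(i < N) x ^+ (bump 0 i ^ 2) = \sum_(i < N) x ^+ (i.+1 ^ 2) by [].
by rewrite expr0; ring.
Qed.

(** phi = 1 + 2 e, and (1 + 2 e)^4 = 1 modulo 8. This is how division by
    phi(-y)^2 is avoided: it amounts to multiplication by phi(-y)^2. *)
Lemma phi_pow4 x N : x ^+ N = 0 -> 8%:R = 0 :> R -> phi x N ^+ 4 = 1.
Proof.
move=> xN R8; rewrite phi_sum //; set e := (X in 1 + X *+ 2).
transitivity (1 + 8%:R * (e + 3%:R * e ^+ 2 + 4%:R * e ^+ 3 + 2%:R * e ^+ 4)); first by ring.
by rewrite R8 mul0r addr0.
Qed.

Section Char2.
Hypothesis R2 : 2%:R = 0 :> R.

Lemma oppr_2eq0 x : - x = x.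
Proof. by apply/eqP; rewrite eq_sym -addr_eq0 -mulr2n -mulr_natr R2 mulr0. Qed.

Lemma euler_sqr x N : euler (x ^+ 2) N = euler x N ^+ 2.
Proof. by rewrite /euler -qpoch_pm oppr_2eq0 expr2. Qed.

Lemma phi_char2 x N : x ^+ N = 0 -> phi x N = 1.
Proof. by move=> xN; rewrite phi_sum // -mulr_natr R2 mulr0 addr0. Qed.

(** The triple product gives psi(x) = (-x; x^4) (-x^3; x^4) f_4, which in
    characteristic 2 is (x; x^2) f_2^2 = f_1 f_2 = f_1^3. *)
Lemma psi_char2 x N : x ^+ N = 0 -> psi x N = euler x N ^+ 3.
Proof.
move=> xN; rewrite psi_theta // -jacobi_triple ?(nilpX xN) // !oppr_2eq0 -!exprSr.
have x2N : (x ^+ 2) ^+ N = 0 by apply: nilpX.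
rewrite -/(euler _ N) [_ * qpoch x _ _]mulrC.
have -> : qpoch x (x ^+ 4) N * qpoch (x ^+ 3) (x ^+ 4) N = qpoch x (x ^+ 2) N.
  rewrite -(@qpoch_stable _ x (x ^+ 2) N (N + N)) ?leq_addr // qpoch_split2.
  by rewrite -exprS -exprM.
have -> : x ^+ 4 = (x ^+ 2) ^+ 2 by rewrite -exprM.
by rewrite euler_sqr expr2 mulrA -euler_split // euler_sqr; ring.
Qed.

(** Euler's pentagonal number theorem: in characteristic 2 the triple product
    f(x^2, x) is the product of the three residue classes of factors of f_1. *)
Lemma pentagonal_char2 x N : x ^+ N = 0 -> euler x N = theta (x ^+ 2) x N.
Proof.
move=> xN; rewrite -jacobi_triple ?(nilpX xN) // !oppr_2eq0 -!exprSr.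
rewrite /euler -(@qpoch_stable _ x x N (N + N + N)) // -?addnA ?leq_addr // addnA.
by rewrite qpoch_split3 -expr2 -exprS; ring.
Qed.

(** Both sides are f_1^19 = f_1 f_2^3 f_4^3 = f_16 f_1^3. The right-hand side is
    preferred because it leads to a binary quadratic form. *)
Lemma ternary_to_binary x N : x ^+ N = 0 ->
  euler x N * psi (x ^+ 2) N * psi (x ^+ 4) N =
  theta (x ^+ 32) (x ^+ 16) N * psi x N.
Proof.
move=> xN.
have e4 : x ^+ 4 = (x ^+ 2) ^+ 2 by rewrite -exprM.
have e16 : x ^+ 16 = (((x ^+ 2) ^+ 2) ^+ 2) ^+ 2 by rewrite -!exprM.
have e32 : x ^+ 32 = (x ^+ 16) ^+ 2 by rewrite -!exprM.
have x2N : (x ^+ 2) ^+ N = 0 by apply: nilpX.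
have x4N : ((x ^+ 2) ^+ 2) ^+ N = 0 by apply: nilpX.
rewrite e32 -pentagonal_char2 ?(nilpX xN) // e16 e4.
by rewrite !psi_char2 // !euler_sqr; ring.
Qed.
End Char2.
End Theta.

(** * The generating function evaluated at a nilpotent argument *)

(** Whether part a may occur i times in a partition counted by EObar whose
    largest even part is 2j. The value j = 0 stands for the absence of even
    parts. *)
Definition allowed (j a i : nat) : bool :=
  (if a == 0 then i == 0
   else if odd a then if j.*2 < a then ~~ odd i else i == 0
   else if a == j.*2 then odd i
   else if a < j.*2 then ~~ odd i else i == 0)%N.

Section EOgen.
Variable R : comNzRingType.
Implicit Types (x y z : R) (N : nat).

Definition part_gf x N j a : R := \sum_(i < N | allowed j a i) x ^+ (a * i).

(** The bound 2j < N is that of the parts themselves: for larger j, no factor of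
    the product would impose the presence of the part 2j. *)
Definition EO_gf x N : R := \sum_(j < N | (j.*2 < N)%N) \prod_(a < N) part_gf x N j a.

Lemma even_geom z N : z ^+ N = 0 -> (1 - z ^+ 2) * \sum_(i < N | ~~ odd i) z ^+ i = 1.
Proof.
move=> zN.
have -> : (1 - z ^+ 2) * \sum_(i < N | ~~ odd i) z ^+ i = 1 - z ^+ (N + odd N).
  elim: N {zN} => [|N IH]; first by rewrite big_ord0 mulr0 subrr.
  rewrite big_mkcond big_ord_recr -big_mkcond mulrDr IH /=.
  case: (odd N) => /=; first by rewrite mulr0 addr0 addn0 addn1.
  by rewrite addn0 addn1 !exprS; ring.
by rewrite (nilp_le zN) ?leq_addr // subr0.
Qed.

Lemma odd_geom z N : z ^+ N = 0 -> (1 - z ^+ 2) * \sum_(i < N | odd i) z ^+ i = z.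
Proof.
move=> zN.
have -> : (1 - z ^+ 2) * \sum_(i < N | odd i) z ^+ i = z - z ^+ (N + ~~ odd N).
  elim: N {zN} => [|N IH]; first by rewrite big_ord0 mulr0 expr1 subrr.
  rewrite big_mkcond big_ord_recr -big_mkcond mulrDr IH /=.
  case: (odd N) => /=; last by rewrite mulr0 addr0 addn0 addn1.
  by rewrite addn0 addn1 !exprS; ring.
by rewrite (nilp_le zN) ?leq_addr // subr0.
Qed.

Section Fixed.
Variables (x : R) (N : nat).
Hypothesis xN : x ^+ N = 0.
Let y := x ^+ 2.
Let h b := \sum_(i < N | ~~ odd i) (y ^+ b) ^+ i.

Lemma nilp_gt0 : (0 < N)%N.
Proof. by rewrite lt0n; apply/eqP => N0; move: xN; rewrite N0 => /eqP; rewrite oner_eq0. Qed.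
Let xkN k (k0 : (0 < k)%N) : (x ^+ k) ^+ N = 0 := nilpX xN k0.
Let yN : y ^+ N = 0 := nilpX xN (isT : (0 < 2)%N).
Let N_gt0 := nilp_gt0.

Lemma part_gf_big j a : (N <= a)%N -> allowed j a 0 -> part_gf x N j a = 1.
Proof.
move=> le al; rewrite /part_gf (bigD1 (Ordinal N_gt0)) //= muln0 expr0.
rewrite big1 ?addr0 // => i /andP[_ i0].
have i_neq0 : (i != 0 :> nat)%N by apply: contraNneq i0 => i0; apply/eqP/val_inj.
by rewrite exprM (nilp_le xN le) expr0n (negPf i_neq0).
Qed.

Lemma part_gf_only0 j a : (forall i, allowed j a i = (i == 0%N)) ->
  part_gf x N j a = 1.
Proof.
move=> al; rewrite /part_gf (big_pred1 (Ordinal N_gt0)) ?muln0 //.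
Qed.

Lemma part_gf_even j a : (forall i, allowed j a i = ~~ odd i) ->
  part_gf x N j a = \sum_(i < N | ~~ odd i) (x ^+ a) ^+ i.
Proof.
by move=> al; apply: eq_big => i; rewrite ?al // exprM.
Qed.

Lemma part_gf_odd j b :
  part_gf x N j b.*2.+1 * (1 - y * (y ^+ 2) ^+ b) =
  if (b < j)%N then 1 - y * (y ^+ 2) ^+ b else 1.
Proof.
have E : y * (y ^+ 2) ^+ b = (x ^+ b.*2.+1) ^+ 2.
  by rewrite /y -!exprM -exprD; congr (_ ^+ _); lia.
have lt : (j.*2 < b.*2.+1)%N = ~~ (b < j)%N by rewrite ltnS leq_double -leqNgt.
case: ifP lt => bj lt.
  by rewrite part_gf_only0 ?mul1r // => i; rewrite /allowed /= odd_double /= lt.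
rewrite part_gf_even => [|i]; last by rewrite /allowed /= odd_double /= lt.
by rewrite E mulrC even_geom // xkN.
Qed.

Lemma part_gf_double j b : part_gf x N j b.+1.*2 =
  (if (b < j)%N then h b.+1 else 1) * (if b.+1 == j then y ^+ j else 1).
Proof.
have E : y ^+ b.+1 = x ^+ b.+1.*2 by rewrite /y -exprM mul2n.
have bN : (x ^+ b.+1.*2) ^+ N = 0 by apply: xkN.
rewrite /h E; case: (ltngtP b.+1 j) => bj.
- rewrite mulr1; apply: part_gf_even => i.
  by rewrite /allowed double_eq0 odd_double (inj_eq double_inj) ltn_double bj (ltn_eqF bj).
- rewrite mulr1; apply: part_gf_only0 => i.
  by rewrite /allowed double_eq0 odd_double (inj_eq double_inj) ltn_double ltnNge (ltnW bj) (gtn_eqF bj).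
rewrite -bj E.
apply: (@lreg_left_inverse _ _ (\sum_(i < N | ~~ odd i) (x ^+ b.+1.*2) ^+ i)).
  by rewrite mulrC; apply: (even_geom bN).
rewrite mulrA even_geom // mul1r.
rewrite -[RHS](odd_geom bN); congr (_ * _).
by apply: eq_big => i; rewrite ?exprM // /allowed double_eq0 odd_double eqxx.
Qed.

Lemma prod_double (F : nat -> R) n :
  \prod_(k < n + n) F k = (\prod_(b < n) F b.*2) * (\prod_(b < n) F b.*2.+1).
Proof.
elim: n => [|n IH]; first by rewrite !big_ord0 mulr1.
by rewrite addnS addSn !big_ord_recr /= IH -addnn; ring.
Qed.

Lemma prod_cond (F : nat -> R) j n : (j <= n)%N ->
  \prod_(b < n) (if (b < j)%N then F b else 1) = \prod_(b < j) F b.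
Proof. by move=> le; rewrite -big_mkcond /= -big_ord_widen. Qed.

(** (y; y^2)_j / (y^2; y^2)_j, with h b the inverse of 1 - y^(2b). *)
Definition EO_coef j := qpoch y (y ^+ 2) j * \prod_(i < j) h i.+1.

(** Multiplying by (y; y^2)_oo cancels the odd parts above 2j and leaves the
    factors of (y; y^2)_j; the even parts give y^j / (y^2; y^2)_j. *)
Lemma EO_term j : (j.*2 < N)%N ->
  (\prod_(a < N) part_gf x N j a) * qpoch y (y ^+ 2) N = EO_coef j * y ^+ j.
Proof.
move=> jN.
(* Parts a >= N contribute 1, so even and odd parts can be paired below 2N. *)
have -> : \prod_(a < N) part_gf x N j a = \prod_(a < N + N) part_gf x N j a.
  rewrite big_split_ord /= [X in _ * X]big1 ?mulr1 // => i _.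
  apply: part_gf_big; rewrite ?leq_addr // /allowed.
  have : (j.*2 < N + i)%N by rewrite (leq_trans jN) ?leq_addr.
  move: (N + i)%N => a ja; rewrite ja (gtn_eqF ja) ltnNge (ltnW ja) /=.
  by rewrite !if_same.
have -> : \prod_(a < N + N) part_gf x N j a =
   (\prod_(b < N) part_gf x N j b.*2) * (\prod_(b < N) part_gf x N j b.*2.+1).
  exact: prod_double.
rewrite -mulrA -[X in _ * X = _]big_split /=.
under [X in _ * X = _]eq_bigr do rewrite part_gf_odd.
rewrite (prod_cond (fun b => 1 - y * (y ^+ 2) ^+ b)); last by lia.
rewrite mulrC /EO_coef -mulrA; congr (_ * _).
have [n NE] : exists n, N = n.+1 by exists N.-1; rewrite prednK.
have -> : \prod_(b < N) part_gf x N j b.*2 = \prod_(b < n) part_gf x N j b.+1.*2.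
  have split0 (F : nat -> R) : \prod_(b < N) F b = F 0%N * \prod_(b < n) F b.+1.
    by rewrite NE big_ord_recl.
  by rewrite (split0 (fun b => part_gf x N j b.*2)) part_gf_only0 // mul1r.
under eq_bigr do rewrite part_gf_double.
rewrite big_split /= (prod_cond (fun b => h b.+1)); last by lia.
congr (_ * _); case: j jN => [|j] jN; first by rewrite big1.
rewrite -big_mkcond /= (big_pred1 (@Ordinal n j _)) //; first by lia.
Qed.

(** The terms of [EO_term] are those of the q-binomial theorem with base y^2 and
    a = z = y. *)
Lemma EO_gf_prod : EO_gf x N * qpoch y (y ^+ 2) N ^+ 2 = euler (y ^+ 2) N.
Proof.
rewrite expr2 mulrA /EO_gf mulr_suml.
have -> : \sum_(i < N | (i.*2 < N)%N)
     (\prod_(a < N) part_gf x N i a) * qpoch y (y ^+ 2) N =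
   \sum_(i < N) EO_coef i * y ^+ i.
  rewrite big_mkcond; apply: eq_bigr => i _ /=; case: ifP => lt.
    exact: EO_term.
  rewrite /y -exprM (@nilp_le _ _ N (2 * i)) ?mulr0 //.
  by rewrite mul2n leqNgt lt.
have c0 : EO_coef 0 = 1 by rewrite /EO_coef /qpoch !big_ord0 mulr1.
rewrite mulrC (@qbinomial _ EO_coef y) ?(nilpX yN) // => j.
rewrite /EO_coef qpochS big_ord_recr /=.
have : (1 - (y ^+ j.+1) ^+ 2) * h j.+1 = 1.
  by apply: even_geom; apply: (nilpX yN).
rewrite -exprM mulnC exprM => e.
transitivity (qpoch y (y ^+ 2) j * \prod_(i < j) h i.+1 *
  (1 - y * (y ^+ 2) ^+ j) * ((1 - (y ^+ 2) ^+ j.+1) * h j.+1)).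
  by ring.
by rewrite e mulr1.
Qed.

End Fixed.

(** The factor f_1 / phi(-t)^2 modulo 8, by [phi_pow4]. The four definitions
    below are the components of the generating function according to the
    exponent of x modulo 8, in the variable t = x^8; the last one is taken
    without its factor 4. *)
Definition theta_weight t N : R := euler t N * phi (- t) N ^+ 2.
Definition EO_class0 t N : R := theta_weight t N * phi t N * phi (t ^+ 2) N.
Definition EO_class2 t N : R := theta_weight t N * psi (t ^+ 2) N * phi (t ^+ 2) N *+ 2.
Definition EO_class4 t N : R := theta_weight t N * phi t N * psi (t ^+ 4) N *+ 2.
Definition EO_class6 t N : R := theta_weight t N * psi (t ^+ 2) N * psi (t ^+ 4) N.

Lemma EO_gf_dissect x N : x ^+ N = 0 -> 8%:R = 0 :> R ->
  let t := x ^+ 8 in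
  EO_gf x N = EO_class0 t N + x ^+ 2 * EO_class2 t N + x ^+ 4 * EO_class4 t N
    + x ^+ 6 * (EO_class6 t N *+ 4).
Proof.
move=> xN R8 t.
have x2N : (x ^+ 2) ^+ N = 0 by apply: nilpX.
have tN : t ^+ N = 0 by apply: nilpX.
have ntN : (- t) ^+ N = 0 by rewrite exprNn tN mulr0.
have x4N : (x ^+ 4) ^+ N = 0 by apply: nilpX.
have := EO_product_dissect x2N (EO_gf_prod xN).
have -> : (x ^+ 2) ^+ 4 = t by rewrite -exprM.
have -> : (x ^+ 2) ^+ 2 = x ^+ 4 by rewrite -exprM.
move/(congr1 (fun z => z * phi (- t) N ^+ 2)); rewrite -mulrA -exprD phi_pow4 // mulr1 => ->.
rewrite (phi_dissect x2N) (phi_dissect x4N).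
have -> : (x ^+ 2) ^+ 4 = t by rewrite -exprM.
have -> : (x ^+ 2) ^+ 8 = t ^+ 2 by rewrite -!exprM.
have -> : (x ^+ 4) ^+ 4 = t ^+ 2 by rewrite -!exprM.
have -> : (x ^+ 4) ^+ 8 = t ^+ 4 by rewrite -!exprM.
by rewrite /EO_class0 /EO_class2 /EO_class4 /EO_class6 /theta_weight; ring.
Qed.

End EOgen.

Section Morph.
Variables (R S : comNzRingType) (f : {rmorphism R -> S}).

Lemma rmorph_theta u v N : f (theta u v N) = theta (f u) (f v) N.
Proof.
by rewrite rmorph_sum; apply: eq_bigr => i _; rewrite rmorphM rmorphD !rmorphXn.
Qed.

Lemma rmorph_phi x N : f (phi x N) = phi (f x) N.
Proof. exact: rmorph_theta. Qed.

Lemma rmorph_psi x N : f (psi x N) = psi (f x) N.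
Proof. by rewrite rmorph_sum; apply: eq_bigr => i _; rewrite rmorphXn. Qed.

Lemma rmorph_euler x N : f (euler x N) = euler (f x) N.
Proof.
by rewrite rmorph_prod; apply: eq_bigr => i _; rewrite rmorphB rmorph1 rmorphM rmorphXn.
Qed.

Lemma rmorph_weight t N : f (theta_weight t N) = theta_weight (f t) N.
Proof. by rewrite rmorphM rmorphXn rmorph_euler rmorph_phi rmorphN. Qed.

Definition rmorph_thetaE :=
  (rmorphMn, rmorphXn, rmorphM, rmorph_weight, rmorph_phi, rmorph_psi).

Lemma rmorph_class0 t N : f (EO_class0 t N) = EO_class0 (f t) N.
Proof. by rewrite !rmorph_thetaE. Qed.

Lemma rmorph_class2 t N : f (EO_class2 t N) = EO_class2 (f t) N.
Proof. by rewrite !rmorph_thetaE. Qed.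

Lemma rmorph_class4 t N : f (EO_class4 t N) = EO_class4 (f t) N.
Proof. by rewrite !rmorph_thetaE. Qed.

Lemma rmorph_class6 t N : f (EO_class6 t N) = EO_class6 (f t) N.
Proof. by rewrite !rmorph_thetaE. Qed.

Lemma rmorph_EO_gf x N : f (EO_gf x N) = EO_gf (f x) N.
Proof.
rewrite rmorph_sum; apply: eq_bigr => j _; rewrite rmorph_prod.
by apply: eq_bigr => a _; rewrite rmorph_sum; apply: eq_bigr => i _; rewrite rmorphXn.
Qed.
End Morph.

Section Truncation.
Variables (A : comNzRingType) (N : nat).
Local Notation Q := {poly %/ ('X^(N.+1) : {poly A})}.

Lemma qX_nilp : (in_qpoly ('X^(N.+1) : {poly A}) 'X) ^+ N.+1 = 0.
Proof.
rewrite -rmorphXn; apply: val_inj; rewrite /= mk_monic_Xn.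
by rewrite Pdiv.RingMonic.rmodpp // monicXn.
Qed.

Lemma in_qpoly_coef (p q : {poly A}) :
  in_qpoly 'X^(N.+1) p = in_qpoly 'X^(N.+1) q -> forall i, (i <= N)%N -> p`_i = q`_i.
Proof.
move=> /(congr1 (fun r : Q => r : {poly A})) /=; rewrite mk_monic_Xn => E i iN.
have coefE (r : {poly A}) : r`_i = (Pdiv.Ring.rmodp r 'X^(N.+1))`_i.
  rewrite [in LHS](Pdiv.RingMonic.rdivp_eq (monicXn A N.+1) r).
  by rewrite coefD coefMXn ltnS iN add0r.
by rewrite coefE E -coefE.
Qed.
End Truncation.

Lemma coef_X8 (A : comNzRingType) (P : {poly A}) k m :
  (k < 8)%N -> (k != 6)%N -> ('X^k * (P \Po 'X^8))`_(8 * m + 6) = 0.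
Proof.
move=> k8 k6; rewrite coefXnM coef_comp_poly_Xn //; case: ltnP => // le.
by case: ifP => // /dvdnP[c]; lia.
Qed.

(** Only the last component of [EO_gf_dissect] has exponents 6 mod 8. *)
Lemma EO_gf_coef (A : comNzRingType) m : 8%:R = 0 :> A ->
  (EO_gf ('X : {poly A}) (8 * m + 6).+1)`_(8 * m + 6) =
  (EO_class6 ('X : {poly A}) (8 * m + 6).+1)`_m *+ 4.
Proof.
move=> A8; set n := (8 * m + 6)%N; set N := n.+1.
have -> : (EO_gf 'X N)`_n = (EO_class0 'X N \Po 'X^8 + 'X^2 * (EO_class2 'X N \Po 'X^8) +
    'X^4 * (EO_class4 'X N \Po 'X^8) + 'X^6 * (EO_class6 'X N *+ 4 \Po 'X^8))`_n :> A.
  apply: (@in_qpoly_coef _ n) => //.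
  rewrite rmorph_EO_gf EO_gf_dissect ?qX_nilp //; last first.
    by rewrite -(rmorph_nat (in_qpoly _)) -polyC_natr A8 polyC0 rmorph0.
  rewrite rmorph_class0 rmorph_class2 rmorph_class4 [(_ *+ 4) \Po _]rmorphMn rmorph_class6.
  rewrite /= comp_polyX 3!rmorphD /=.
  rewrite [in_qpoly _ ('X^2 * _)]rmorphM [in_qpoly _ ('X^4 * _)]rmorphM.
  rewrite [in_qpoly _ ('X^6 * _)]rmorphM /= [in_qpoly _ (_ *+ 4)]rmorphMn /=.
  by rewrite rmorph_class0 rmorph_class2 rmorph_class4 rmorph_class6 /= !rmorphXn.
rewrite !coefD -[EO_class0 _ _ \Po _]mul1r -(expr0 'X).
rewrite (@coef_X8 _ _ 0) // (@coef_X8 _ _ 2) // (@coef_X8 _ _ 4) // !add0r.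
rewrite coefXnM coef_comp_poly_Xn // ifF; last by rewrite /n; lia.
by rewrite addnK dvdn_mulr // mulKn // coefMn.
Qed.

(** * Partitions as coefficients of the generating function *)

Section Combinatorics.
Variable n : nat.
Implicit Types (f : multiplicities n) (j : nat) (a b : 'I_n.+1).
Local Open Scope nat_scope.

Definition shape j f : bool := [forall a : 'I_n.+1, allowed j a (f a)].

(** If j > 0, the part 2j has odd multiplicity, which no other shape permits. *)
Lemma shape_inj j k f : j.*2 < n.+1 -> k.*2 < n.+1 ->
  shape j f -> shape k f -> j = k.
Proof.
have main i i' : i.*2 < n.+1 -> shape i f -> shape i' f -> 0 < i -> i = i'.
  move=> lt /forallP/(_ (Ordinal lt)) Hi /forallP/(_ (Ordinal lt)) Hi' i0.
  move: Hi Hi'; rewrite /allowed /= odd_double double_eq0 (gtn_eqF i0) eqxx /=.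
  case: (f _) => m mlt /= mo; case: (eqVneq i.*2 i'.*2) => [/double_inj //|_].
  by case: ltnP => _; [rewrite mo|move/eqP => m0; rewrite m0 in mo].
move=> jn kn sj sk; case: (posnP j) (posnP k) => [j0|j0] [k0|k0].
- by rewrite j0 k0.
- by apply/esym; apply: main sk sj k0.
- exact: main sj sk j0.
exact: main sj sk j0.
Qed.

Lemma shape_EObar j f : j.*2 < n.+1 -> shape j f -> \sum_(a < n.+1) a * f a == n ->
  EObar_partition f.
Proof.
move=> jn /forallP sh sumn.
have evle a : is_part f a -> ~~ odd a -> a <= j.*2.
  move=> pa ea; have := sh a; rewrite /allowed (negPf ea).
  rewrite /is_part in pa; rewrite (gtn_eqF pa).
  by case: eqP => // _; case: ltngtP.
have oddlt b : is_part f b -> odd b -> j.*2 < b.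
  move=> pb ob; have := sh b; rewrite /allowed ob.
  rewrite /is_part in pb; rewrite (gtn_eqF pb).
  by case: eqP => // _; case: ltngtP.
apply/andP; split.
  apply/andP; split; first by rewrite /is_partition sumn andbT; have := sh ord0.
  apply/'forall_forallP => a b; apply/implyP => /and4P[pa pb ea ob].
  exact: leq_ltn_trans (evle a pa ea) (oddlt b pb ob).
apply/forallP => a; apply/implyP => pa; have := sh a.
rewrite /allowed; have [oa|ea] := boolP (odd a).
  rewrite /largest_even_part oa andbF (oddlt _ pa oa) eqbF_neg.
  by case: ifP => // /eqP a0; rewrite a0 in oa.
rewrite /is_part in pa; rewrite (gtn_eqF pa).
case: eqP => // _; case: (eqVneq (a : nat) j.*2) => aj.
  move=> ->; apply/eqP/esym/and3P; split=> //.
  by apply/forallP => b; apply/implyP => /andP[pb eb]; rewrite aj evle.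
case: ltnP => // alt oa; rewrite (negPf oa) eq_sym; apply/eqP/negbTE.
apply/and3P => -[_ _ /forallP/(_ (Ordinal jn))] /=.
rewrite odd_double andbT leqNgt alt implybF /is_part -leqNgt leqn0.
have j0 : 0 < j by case: (j) alt.
have := sh (Ordinal jn); rewrite /allowed /= double_eq0 (gtn_eqF j0) odd_double eqxx.
by case: (f _) => -[].
Qed.

(** Conversely, j is half the largest even part, or 0 if all parts are odd. *)
Lemma EObar_shape f : EObar_partition f ->
  \sum_(a < n.+1) a * f a = n /\ exists2 j, j.*2 < n.+1 & shape j f.
Proof.
case/andP => /andP[/andP[/eqP f0 /eqP fsum] /forallP ebo] /forallP par; split=> //.
have ev0 b : (b : nat) = 0 -> f b = 0 :> nat.
  by move=> b0; rewrite -f0; congr (_ (f _)); apply: val_inj.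
have parE b : is_part f b -> odd (f b) = largest_even_part f b.
  by move=> pb; apply/eqP; have := par b; rewrite pb.
have npart b : is_part f b = false -> f b = 0 :> nat.
  by rewrite /is_part lt0n => /negbFE/eqP.
have oddmult b : odd b -> ~~ odd (f b).
  move=> ob; have [pb|/negbTE/npart -> //] := boolP (is_part f b).
  by rewrite parE // /largest_even_part ob andbF.
have [/existsP[a0 pa0]|none] := boolP [exists a, is_part f a && ~~ odd a].
  case: (@arg_maxnP _ a0 (fun a => is_part f a && ~~ odd a) (fun a => a) pa0).
  move=> a /andP[pa ea] amax.
  have aE : a./2.*2 = a by have := odd_double_half a; rewrite (negPf ea).
  exists a./2; first by rewrite aE.
  apply/forallP => b; rewrite /allowed aE; case: eqP => [/ev0 -> //|/eqP b0].
  have [ob|eb] := boolP (odd b).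
    case: ltnP => ba; first exact: oddmult.
    apply/eqP/npart/negbTE/negP => pb.
    by have /forallP/(_ b) := ebo a; rewrite pa pb ea ob /= ltnNge ba.
  case: eqP => [ba|/eqP ba].
    have {b0 eb ba} -> : b = a by apply: val_inj.
    rewrite parE // /largest_even_part pa ea; apply/forallP => c.
    by apply/implyP => /amax.
  case: ltnP => lt.
    have [pb|/negbTE/npart -> //] := boolP (is_part f b).
    rewrite parE //; apply/and3P => -[_ _ /forallP/(_ a)].
    by rewrite pa ea /= leqNgt lt.
  apply/eqP/npart/negbTE/negP => pb.
  have := amax b; rewrite pb eb /= => /(_ isT) ba'.
  by move: ba; rewrite eqn_leq ba' lt.
exists 0 => //; apply/forallP => b; rewrite /allowed.
case: eqP => [/ev0 -> //|/eqP b0]; have [ob|eb] := boolP (odd b).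
  by rewrite lt0n b0 oddmult.
rewrite double0 ltn0; apply/eqP/npart/negbTE; apply: contra none => pb.
by apply/existsP; exists b; rewrite pb.
Qed.

Local Open Scope ring_scope.

(** Expanding the product over parts enumerates the multiplicity functions of
    each shape, and every partition counted by EObar has exactly one shape. *)
Lemma EObar_coef (A : comNzRingType) :
  (EO_gf ('X : {poly A}) n.+1)`_n = (EObar_nat n)%:R.
Proof.
pose ok (f : multiplicities n) (j : nat) := shape j f && (\sum_(a < n.+1) a * f a == n)%N.
transitivity (\sum_(j < n.+1 | (j.*2 < n.+1)%N) \sum_(f : multiplicities n) (ok f j)%:R : A).
  rewrite coef_sum; apply: eq_bigr => j _.
  rewrite bigA_distr_big_dep coef_sum.
  rewrite [LHS]big_mkcond /=; apply: eq_bigr => f _.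
  have -> : (f \in family (fun a : 'I_n.+1 => [pred i : 'I_n.+1 | allowed j a i])) = shape j f.
    by apply/familyP/forallP.
  rewrite /ok; case: (shape j f) => //=.
  by rewrite prodrXr coefXn eq_sym.
rewrite exchange_big /= /EObar_nat -sum1_card natr_sum [RHS]big_mkcond /=.
apply: eq_bigr => f _; rewrite inE.
have [fE|nE] := boolP (EObar_partition f).
  have [sumE [j jn jf]] := EObar_shape fE.
  have jn' : (j < n.+1)%N by lia.
  rewrite (bigD1 (Ordinal jn')) //= /ok jf sumE eqxx big1 ?addr0 // => i /andP[i1 i2].
  case: (boolP (shape i f)) => // si; case/eqP: i2; apply: val_inj => /=.
  exact: shape_inj si jf.
rewrite big1 // => j jn; rewrite /ok.
case: (boolP (shape j f)) => //= sj; case: eqP => // sm.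
by case/negP: nE; apply: shape_EObar sj _ => //; apply/eqP.
Qed.

End Combinatorics.

(** * From partitions to the form 16 X^2 + 3 Y^2 *)

(** When M = 19 mod 24 the equation forces Y odd and X prime to 3, so the parity
    of X is the only condition to impose. *)
Definition is_rep (M X Y : nat) : bool := (odd X && (16 * X ^ 2 + 3 * Y ^ 2 == M))%N.
Definition reps (M : nat) : {set 'I_M.+1 * 'I_M.+1} :=
  [set z : 'I_M.+1 * 'I_M.+1 | is_rep M z.1 z.2].

Section NatSums.
Local Open Scope nat_scope.

Lemma sum_stable (F : nat -> nat) a b : (forall k, a <= k -> F k = 0) ->
  (forall k, b <= k -> F k = 0) -> \sum_(k < a) F k = \sum_(k < b) F k.
Proof.
wlog le : a b / a <= b => [H Fa Fb|Fa _].
  by case/orP: (leq_total a b) => le; [|apply/esym]; apply: H.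
rewrite -(subnKC le) big_split_ord /= [X in _ + X]big1 ?addn0 // => i _.
by apply: Fa; rewrite leq_addr.
Qed.

Lemma sum_mod6 (F : nat -> nat) n : (forall k, F (6 * k) = 0) ->
  (forall k, F (6 * k + 2) = 0) -> (forall k, F (6 * k + 3) = 0) ->
  (forall k, F (6 * k + 4) = 0) ->
  \sum_(k < 6 * n) F k = \sum_(k < n) (F (6 * k + 1) + F (6 * k + 5)).
Proof.
move=> F0 F2 F3 F4; elim: n => [|n IH]; first by rewrite !big_ord0.
have -> : 6 * n.+1 = (6 * n).+1.+1.+1.+1.+1.+1 by lia.
rewrite !big_ord_recr /= IH -(addn1 (6 * n)) -!addnS.
by rewrite F0 F2 F3 F4 !addn0 addnA.
Qed.

Lemma sum_odd (F : nat -> nat) n : (forall k, F k.*2 = 0) ->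
  \sum_(k < n.*2) F k = \sum_(k < n) F k.*2.+1.
Proof.
move=> F0; elim: n => [|n IH]; first by rewrite !big_ord0.
by rewrite doubleS !big_ord_recr /= IH F0 addn0.
Qed.

Lemma card_reps M : #|reps M| = \sum_(X < M.+1) \sum_(Y < M.+1) is_rep M X Y.
Proof.
rewrite pair_big /= -sum1_card big_mkcond; apply: eq_bigr => -[X Y] _ /=.
by rewrite inE; case: is_rep.
Qed.

(** X = 6k + 1 or 6k + 5 and Y = 2l + 1: the exponents of f_16 are
    16 (X^2 - 1) / 24 and those of psi are (Y^2 - 1) / 8. *)
Lemma card_reps_param m N : m < N ->
  #|reps (24 * m + 19)| = \sum_(k < N) \sum_(l < N)
    ((32 * 'C(k.+1, 2) + 16 * 'C(k, 2) + 'C(l.+1, 2) == m) +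
     (32 * 'C(k.+1, 2) + 16 * 'C(k.+2, 2) + 'C(l.+1, 2) == m)).
Proof.
move=> mN; rewrite card_reps; set M := 24 * m + 19.
have sq k : k <= k ^ 2 by rewrite -mulnn; case: k => // k; rewrite leq_pmulr.
have inner X : \sum_(Y < M.+1) is_rep M X Y = \sum_(l < N) is_rep M X l.*2.+1.
  pose G Y := nat_of_bool (is_rep M X Y).
  have G0 k : G k.*2 = 0.
    rewrite /G /is_rep; case: eqP; rewrite ?andbF // => E; exfalso.
    by move: E; rewrite /M -!mulnn -!muln2; lia.
  rewrite -(@sum_odd G) //; apply: (@sum_stable G) => k le; rewrite /G /is_rep.
    case: eqP; rewrite ?andbF // => E; have := sq k; move: E; rewrite /M in le *; lia.
  case: eqP; rewrite ?andbF // => E; exfalso.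
  have : k * N.*2 <= k ^ 2 by rewrite -mulnn leq_mul2l le orbT.
  have := sq X; move: E le; rewrite /M; nia.
under eq_bigr do rewrite inner.
pose F X := \sum_(l < N) is_rep M X l.*2.+1.
have even0 X : ~~ odd X -> F X = 0.
  by move=> eX; rewrite /F big1 // => l _; rewrite /is_rep (negPf eX).
have big0 k : M < 16 * k ^ 2 -> F k = 0.
  move=> lt; rewrite /F big1 // => l _; rewrite /is_rep.
  by case: eqP; rewrite ?andbF // => E; move: lt; rewrite -E; lia.
rewrite (@sum_stable F M.+1 (6 * N)); last first.
- by move=> k le; apply: big0; have := sq k; rewrite /M; lia.
- by move=> k le; apply: big0; have := sq k; lia.
rewrite sum_mod6; last first.
- by move=> k; apply: even0; rewrite oddD oddM.
- move=> k; rewrite /F big1 // => l _; rewrite /is_rep.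
  by case: eqP; rewrite ?andbF // /M -!mulnn; lia.
- by move=> k; apply: even0; rewrite oddD oddM.
- by move=> k; apply: even0; rewrite oddM.
apply: eq_bigr => k _; rewrite -big_split /=; apply: eq_bigr => l _.
have b1 := mul2_bin2 k; have b2 := mul2_bin2 l.
congr (nat_of_bool _ + nat_of_bool _); rewrite /is_rep /M oddD oddM /=.
  by rewrite -!mulnn -muln2; move: b1 b2; rewrite [in 'C(k.+1, _)]binS bin1; lia.
by rewrite -!mulnn -muln2 [in 'C(k.+2, _)]binS bin1; lia.
Qed.

End NatSums.

Section Char2Coef.
Variables (A : comNzRingType).
Hypothesis A2 : 2%:R = 0 :> A.

Lemma class6_coef_char2 m N : (m < N)%N ->
  (EO_class6 ('X : {poly A}) N)`_m = #|reps (24 * m + 19)|%:R.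
Proof.
case: N => // N mN; rewrite (card_reps_param mN).
transitivity ((theta 'X^32 'X^16 N.+1 * psi 'X N.+1 : {poly A})`_m).
  apply: (@in_qpoly_coef _ N) => //.
  rewrite rmorph_class6 rmorphM rmorph_theta rmorph_psi !rmorphXn /=.
  have xN := qX_nilp A N; set x := in_qpoly _ _ in xN *.
  have Q2 : 2%:R = 0 :> {poly %/ ('X^(N.+1) : {poly A})}.
    by rewrite -(rmorph_nat (in_qpoly _)) -polyC_natr A2 polyC0 rmorph0.
  rewrite -ternary_to_binary // /EO_class6 /theta_weight phi_char2 ?expr1n ?mulr1 //.
  by rewrite exprNn xN mulr0.
rewrite /theta mulr_suml coef_sum natr_sum; apply: eq_bigr => k _.
rewrite mulr_sumr coef_sum natr_sum; apply: eq_bigr => l _.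
rewrite mulrDr mulrDl coefD natrD -!exprM -!exprD !coefXn.
by rewrite ![_ == m]eq_sym.
Qed.
End Char2Coef.

(** The integer c with EObar(8m+6) = 4 c modulo 8 is a coefficient of an integral
    polynomial, so its parity may be read over F_2. *)
Lemma EObar_reps m : ~~ odd #|reps (24 * m + 19)| -> (8 %| EObar_nat (8 * m + 6))%N.
Proof.
move=> even_reps; set N := (8 * m + 6).+1.
pose c := (EO_class6 ('X : {poly int}) N)`_m.
have coefE (A : comNzRingType) : (EO_class6 ('X : {poly A}) N)`_m = c%:~R.
  have := rmorph_class6 (map_poly (intr : int -> A)) 'X N.
  by rewrite /= map_polyX => <-; rewrite coef_map.
have mN : (m < N)%N by rewrite /N; lia.
have F2 : 2%:R = 0 :> 'F_2 by apply: val_inj.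
have Z8 : 8%:R = 0 :> 'Z_8 by apply: val_inj.
have c2 : (2%:Z %| c)%Z.
  rewrite (@dvdz_pcharf 'F_2 2) ?pchar_Fp // -coefE class6_coef_char2 //.
  by rewrite -(dvdn_pcharf (pchar_Fp _)) // dvdn2.
have := EObar_coef (8 * m + 6) 'Z_8.
rewrite EO_gf_coef // -/N coefE; have /dvdzP[d ->] := c2.
have -> : (d * 2)%:~R *+ 4 = 0 :> 'Z_8.
  by rewrite intrM -mulrnAr (_ : 2%:~R *+ 4 = 0) ?mulr0 //; apply: val_inj.
move/(congr1 val); rewrite /= val_Zp_nat // => e.
by rewrite /dvdn -e.
Qed.

(** * Primes of the form u^2 + 48 w^2 *)

(** A cube root of unity z <> 1 in F_p satisfies (2 z + 1)^2 = -3. *)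
Lemma neg3_square p : prime p -> (p = 1 %[mod 3])%N -> exists c : nat, (p %| c ^ 2 + 3)%N.
Proof.
move=> pp p3; have d3 : (3 %| #|[set: {unit 'F_p}]|)%N.
  rewrite card_finField_unit card_Fp //.
  by move: p3; have := prime_gt1 pp; lia.
have [x _ ox] := Cauchy (isT : prime 3) d3.
pose z : 'F_p := FinRing.uval x.
have z3 : z ^+ 3 = 1 by rewrite -FinRing.val_unitX -ox expg_order FinRing.val_unit1.
have z1 : z != 1.
  apply: contra_eqN ox => /eqP z1; have -> : x = 1%g by apply: val_inj.
  by rewrite order1.
have zz : z ^+ 2 + z + 1 = 0.
  have : (z - 1) * (z ^+ 2 + z + 1) = 0.
    by transitivity (z ^+ 3 - 1); [ring | rewrite z3 subrr].
  by move/eqP; rewrite mulf_eq0 subr_eq0 (negPf z1) => /eqP.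
exists (z *+ 2 + 1 : 'F_p); rewrite (dvdn_pcharf (pchar_Fp pp)) natrD natrX natr_Zp.
apply/eqP; transitivity ((z ^+ 2 + z + 1) *+ 4); first by ring.
by rewrite zz mul0rn.
Qed.

Lemma floor_sqrt p : exists s, (s ^ 2 <= p < s.+1 ^ 2)%N.
Proof.
elim: p => [|p [s /andP[s1 s2]]]; first by exists 0%N.
have [e|ne] := eqVneq p.+1 (s.+1 ^ 2)%N.
  by exists s.+1; rewrite e leqnn ltn_exp2r // ltnSn.
by exists s; rewrite (leqW s1) ltn_neqAle ne.
Qed.

Lemma prime_not_square p s : prime p -> (s ^ 2 != p)%N.
Proof.
move=> pp; apply/eqP => e; move: pp; rewrite -e -mulnn => /primeP[gt1].
by move/(_ s (dvdn_mulr s (dvdnn s))); nia.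
Qed.

(** Thue's lemma: there are more than p pairs (i, j) with 0 <= i, j <= sqrt p, so
    i + c j takes the same value modulo p at two of them. *)
Lemma thue p (c : nat) : prime p -> exists a b : int,
  [/\ (p%:Z %| a + c%:Z * b)%Z, (a ^+ 2 < p%:Z), (b ^+ 2 < p%:Z) & (a, b) != (0, 0)].
Proof.
move=> pp; have [s /andP[s1 s2]] := floor_sqrt p.
have p0 := prime_gt0 pp.
pose f (z : 'I_s.+1 * 'I_s.+1) : 'I_p := Ordinal (ltn_pmod (z.1 + c * z.2)%N p0).
have /injectivePn[x [y xy fxy]] : ~~ injectiveb f.
  apply/injectiveP => /leq_card; rewrite card_prod !card_ord leqNgt.
  by rewrite mulnn s2.
exists (x.1%:Z - y.1%:Z), (x.2%:Z - y.2%:Z).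
have sq (i j : 'I_s.+1) : (i%:Z - j%:Z) ^+ 2 < p%:Z.
  have lt : (s ^ 2 < p)%N by rewrite ltn_neqAle prime_not_square.
  have := ltn_ord i; have := ltn_ord j; move: lt; rewrite -mulnn; nia.
split=> //; last first.
  apply: contra xy => /eqP[/eqP + /eqP]; rewrite !subr_eq0 !eqz_nat => /eqP e1 /eqP e2.
  by apply/eqP; case: x y e1 e2 {fxy} => x1 x2 [y1 y2] /= /val_inj -> /val_inj ->.
have /(congr1 val)/= e := fxy.
have ex := divn_eq (x.1 + c * x.2) p; have ey := divn_eq (y.1 + c * y.2) p.
rewrite e in ex; apply/dvdzP.
move: ex ey; move: (_ %/ p)%N (_ %/ p)%N (_ %% p)%N => q1 q2 r.
move: (x.1 : nat) (x.2 : nat) (y.1 : nat) (y.2 : nat) => x1 x2 y1 y2 ex ey.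
by exists (q2%:Z - q1%:Z); lia.
Qed.

(** Thue's lemma applied to a square root of -3 gives a^2 + 3 b^2 = k p with
    0 < k < 4. The case k = 2 is impossible modulo 4, and k = 3 reduces to k = 1
    by dividing a by 3. *)
Lemma prime_x2_3y2 p : prime p -> (p = 1 %[mod 3])%N ->
  exists a b : int, a ^+ 2 + 3 * b ^+ 2 = p%:Z.
Proof.
move=> pp p3; have [c /dvdnP[d cd]] := neg3_square pp p3.
have [a [b [/dvdzP[e ab] ap bp nz]]] := thue c pp.
have p_gt0 := prime_gt0 pp.
have [k kE] : exists k : int, a ^+ 2 + 3 * b ^+ 2 = k * p%:Z.
  have aE : a = e * p%:Z - c%:Z * b by lia.
  (* k = (a^2 + 3 b^2) / p after substituting a = e p - c b and c^2 + 3 = d p *)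
  exists (e ^+ 2 * p%:Z - 2 * e * c%:Z * b + d%:Z * b ^+ 2).
  have cdz : c%:Z ^+ 2 + 3 = d%:Z * p%:Z by lia.
  transitivity ((e * p%:Z) ^+ 2 - 2 * (e * p%:Z) * (c%:Z * b) + (c%:Z ^+ 2 + 3) * b ^+ 2).
    by rewrite aE; ring.
  by rewrite cdz; ring.
have a0 := sqr_ge0 a; have b0 := sqr_ge0 b.
have pz : 0 < p%:Z by lia.
have k4 : k < 4 by rewrite -(ltr_pM2r pz) -kE; lia.
have k0 : 0 < k.
  rewrite -(pmulr_lgt0 k pz) -kE.
  by move: nz; rewrite xpair_eqE negb_and => /orP[] n0;
    have := exprn_even_gt0 _ (isT : ~~ odd 2); [move/(_ _ a)|move/(_ _ b)]; rewrite n0; lia.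
have : k = 1 \/ k = 2 \/ k = 3 by lia.
case=> [k1|[k2|k3]].
- by exists a, b; rewrite kE k1 mul1r.
- have [q qE] : exists q, p = (2 * q + 1)%N.
    have [e2|od] := even_prime pp; first by rewrite e2 in p3.
    by exists p./2; have := odd_double_half p; rewrite od; lia.
  have [x [i [aE i01]]] : exists x i : int, a = 2 * x + i /\ (i = 0 \/ i = 1).
    by exists (a %/ 2)%Z, (a %% 2)%Z; lia.
  have [y [j [bE j01]]] : exists y j : int, b = 2 * y + j /\ (j = 0 \/ j = 1).
    by exists (b %/ 2)%Z, (b %% 2)%Z; lia.
  exfalso; move: kE; rewrite k2 aE bE qE.
  by case: i01 => ->; case: j01 => ->; lia.
have [x [i [aE i012]]] : exists x i : int, a = 3 * x + i /\ (i = 0 \/ i = 1 \/ i = 2).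
  by exists (a %/ 3)%Z, (a %% 3)%Z; lia.
exists b, x; move: kE; rewrite k3 aE.
by case: i012 => [->|[->|->]]; lia.
Qed.

(** Modulo 8, the equation a^2 + 3 b^2 = 1 forces b = 0 modulo 4. *)
Lemma prime_x2_48y2 p : prime p -> (p = 1 %[mod 24])%N ->
  exists u w : int, u ^+ 2 + 48 * w ^+ 2 = p%:Z.
Proof.
move=> pp p24; have p3 : (p = 1 %[mod 3])%N by lia.
have [a [b ab]] := prime_x2_3y2 pp p3.
have [t tE] : exists t, p = (24 * t + 1)%N by exists (p %/ 24)%N; lia.
have [x [i [aE iE]]] : exists x i : int, a = 4 * x + i /\ [\/ i = 0, i = 1, i = 2 | i = 3].
  exists (a %/ 4)%Z, (a %% 4)%Z; split; first by lia.
  have : (a %% 4)%Z = 0 \/ (a %% 4)%Z = 1 \/ (a %% 4)%Z = 2 \/ (a %% 4)%Z = 3 by lia.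
  by case=> [|[|[|]]] ->; [constructor 1|constructor 2|constructor 3|constructor 4].
have [y [j [bE jE]]] : exists y j : int, b = 4 * y + j /\ [\/ j = 0, j = 1, j = 2 | j = 3].
  exists (b %/ 4)%Z, (b %% 4)%Z; split; first by lia.
  have : (b %% 4)%Z = 0 \/ (b %% 4)%Z = 1 \/ (b %% 4)%Z = 2 \/ (b %% 4)%Z = 3 by lia.
  by case=> [|[|[|]]] ->; [constructor 1|constructor 2|constructor 3|constructor 4].
exists a, y; move: ab; rewrite bE tE.
by case: jE => ->; rewrite aE; case: iE => ->; lia.
Qed.

Lemma Euclid_dvdzM (p : nat) (a b : int) : prime p ->
  (p%:Z %| a * b)%Z = (p%:Z %| a)%Z || (p%:Z %| b)%Z.
Proof. by move=> pp; rewrite !dvdzE abszM Euclid_dvdM. Qed.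

Lemma prime24_gt p : prime p -> (p = 1 %[mod 24])%N -> (24 < p)%N.
Proof. by move/prime_gt1; lia. Qed.

Lemma ndvd_nat p k : prime p -> (p = 1 %[mod 24])%N -> (0 < k < 25)%N ->
  ~~ (p%:Z %| k%:Z)%Z.
Proof.
move=> pp p24 /andP[k0 k25]; rewrite dvdzE /= gtnNdvd //.
by have := prime24_gt pp p24; lia.
Qed.

Lemma norm48_ndvd p (u w Q : int) : prime p -> (p = 1 %[mod 24])%N ->
  u ^+ 2 + 48 * w ^+ 2 = Q -> (p%:Z %| Q)%Z -> (p%:Z %| u)%Z = (p%:Z %| w)%Z.
Proof.
move=> pp p24 uw pQ.
have -> : (p%:Z %| u)%Z = (p%:Z %| u ^+ 2)%Z by rewrite expr2 Euclid_dvdzM // orbb.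
have -> : u ^+ 2 = Q + - (16%:Z * 3%:Z * (w * w)) by rewrite -uw; ring.
by rewrite rpredDl // rpredN !Euclid_dvdzM // orbb !(negPf (ndvd_nat pp p24 _)).
Qed.

(** Coordinates of pi^(e+1), built one factor at a time. The sign s chooses between
    pi and its conjugate so that the product does not become divisible by p:
    the two candidates for the second coordinate have sum 2 w u1, which p does
    not divide. *)
Lemma prime_power_x2_48y2 p e : prime p -> (p = 1 %[mod 24])%N ->
  exists u w : int, [/\ u ^+ 2 + 48 * w ^+ 2 = p%:Z ^+ e.+1,
    ~~ (p%:Z %| u)%Z & ~~ (p%:Z %| w)%Z].
Proof.
move=> pp p24; have [u1 [w1 uw1]] := prime_x2_48y2 pp p24.
have [u1p w1p] : ~~ (p%:Z %| u1)%Z /\ ~~ (p%:Z %| w1)%Z.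
  have E := norm48_ndvd pp p24 uw1 (dvdzz _); rewrite E.
  suff : ~~ (p%:Z %| w1)%Z by [].
  apply/negP => pw; have pu := pw; rewrite -E in pu.
  have [/dvdzP[a aE] /dvdzP[b bE]] := (pu, pw).
  have p0 : p%:Z != 0 by have := prime_gt1 pp; lia.
  have : p%:Z * (p%:Z * (a ^+ 2 + 48 * b ^+ 2)) = p%:Z * 1.
    by rewrite mulr1 -[RHS]uw1 aE bE; ring.
  move/(mulfI p0) => /(congr1 (fun z => (p%:Z %| z)%Z)).
  by rewrite dvdz_mulr // dvdz1 /=; have := prime_gt1 pp; case: (p) => [|[]].
elim: e => [|e [u [w [uw up wp]]]]; first by exists u1, w1; rewrite expr1.
have [s [s2 sp]] : exists s : int, s ^+ 2 = 1 /\ ~~ (p%:Z %| s * u * w1 + w * u1)%Z.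
  have [d1|] := boolP (p%:Z %| u * w1 + w * u1)%Z; last first.
    by exists 1; rewrite mul1r.
  exists (-1); split=> //; apply/negP => d2; have := rpredD d1 d2.
  have -> : u * w1 + w * u1 + (-1 * u * w1 + w * u1) = 2%:Z * (w * u1) by ring.
  rewrite !Euclid_dvdzM // (negPf wp) (negPf u1p) !orbF; apply/negP.
  exact: ndvd_nat.
exists (u * u1 - s * 48 * w * w1), (s * u * w1 + w * u1).
have E : (u * u1 - s * 48 * w * w1) ^+ 2 + 48 * (s * u * w1 + w * u1) ^+ 2 = p%:Z ^+ e.+2.
  rewrite [p%:Z ^+ e.+2]exprSr -uw -uw1.
  transitivity ((u * u1) ^+ 2 + 48 * (w * u1) ^+ 2 +
    s ^+ 2 * (48 * (u * w1) ^+ 2 + (48 * w * w1) ^+ 2)); first by ring.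
  by rewrite s2; ring.
split=> //; rewrite (norm48_ndvd pp p24 E) //.
by rewrite exprS dvdz_mulr.
Qed.

(** * Exchanging conjugate prime powers *)

(** The hypotheses make r the graph of a fixed-point-free involution of B. A
    relation is more convenient than a function here, because the partner of a
    solution is given by an existence statement. *)
Lemma even_matching (T : finType) (B : {set T}) (r : T -> T -> Prop) :
  (forall x, x \in B -> exists2 y, y \in B & r x y) ->
  (forall x y, x \in B -> y \in B -> r x y -> r y x) ->
  (forall x y z, x \in B -> y \in B -> z \in B -> r x y -> r x z -> y = z) ->
  (forall x, x \in B -> ~ r x x) -> ~~ odd #|B|.
Proof.
have [n] := ubnP #|B|; elim: n B => // n IH B; rewrite ltnS => le tot sym fn irr.
have [->|[x xB]] := set_0Vmem B; first by rewrite cards0.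
have [y yB rxy] := tot x xB.
have yx : y != x by apply: contraPneq rxy => ->; apply: irr.
have yB' : y \in B :\ x by rewrite !inE yx.
have cB : #|B| = #|(B :\ x) :\ y|.+2 by rewrite (cardsD1 x) xB (cardsD1 y) yB'.
have sub z : z \in (B :\ x) :\ y -> z \in B by rewrite !inE => /and3P[].
rewrite cB /= negbK; apply: IH.
- by rewrite cB in le; apply: ltnW.
- move=> z zB; have [t tB rzt] := tot z (sub _ zB); exists t => //.
  move: zB; rewrite !inE tB => /and3P[zy zx zB]; rewrite andbT; apply/andP; split.
    apply: contraNneq zx => ty; rewrite ty in rzt tB.
    by apply/eqP/(fn y) => //; apply: sym.
  apply: contraNneq zy => tx; rewrite tx in rzt tB.
  by apply/eqP/(fn x) => //; apply: sym.
- by move=> a b /sub aB /sub bB; apply: sym.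
- by move=> a b c /sub aB /sub bB /sub cinB; apply: fn.
by move=> a /sub; apply: irr.
Qed.

Section Swap.
Variables (u w : int).

(** Let Pi = u + 4 s sqrt(-3), with s = w or -w, divide
    alpha = 4 X + Y sqrt(-3), and let beta = 4 g + h sqrt(-3) be the quotient. The
    partner of alpha is Pi * conj beta, whose conjugate is alpha with Pi replaced
    by conj Pi; absolute values forget signs and conjugation. *)
Definition swap (X Y X' Y' : nat) : Prop := exists s g h : int,
  [/\ s = w \/ s = - w, X%:Z = u * g - 3 * s * h, Y%:Z = u * h + 16 * s * g,
      X' = absz (u * g + 3 * s * h)%R & Y' = absz (u * h - 16 * s * g)%R].

(** Applying the exchange to the partner restores beta up to signs; the four
    cases are the signs hidden by the absolute values. *)
Lemma swap_sym X Y X' Y' : swap X Y X' Y' -> swap X' Y' X Y.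
Proof.
case=> s [g [h [sw XE YE X'E Y'E]]].
have sw' : - s = w \/ - s = - w by case: sw => ->; [right|left]; rewrite ?opprK.
move: X'E; case: (ler0P (u * g + 3 * s * h)) => Xs X'E;
move: Y'E; case: (ler0P (u * h - 16 * s * g)) => Ys Y'E.
- by exists (- s), (- g), (- h); split=> //; lia.
- by exists s, (- g), h; split=> //; lia.
- by exists s, g, (- h); split=> //; lia.
by exists (- s), g, h; split=> //; lia.
Qed.

Lemma absz_sqr (z : int) : (absz z)%:Z ^+ 2 = z ^+ 2.
Proof. by rewrite abszE real_normK ?num_real. Qed.

Lemma swap_norm X Y X' Y' : swap X Y X' Y' ->
  (16 * X ^ 2 + 3 * Y ^ 2 = 16 * X' ^ 2 + 3 * Y' ^ 2)%N.
Proof.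
case=> s [g [h [sw XE YE X'E Y'E]]].
have : 16 * X%:Z ^+ 2 + 3 * Y%:Z ^+ 2 = 16 * X'%:Z ^+ 2 + 3 * Y'%:Z ^+ 2.
  by rewrite X'E Y'E !absz_sqr XE YE; ring.
by clear; lia.
Qed.

Lemma swap_odd X Y X' Y' : swap X Y X' Y' -> odd X = odd X'.
Proof.
case=> s [g [h [sw XE YE X'E Y'E]]].
move: XE X'E; move: (u * g) => a.
have -> : 3 * s * h = 3 * (s * h) by ring.
by move: (s * h) => b; clear; lia.
Qed.

End Swap.

Lemma is_rep_bound M X Y : is_rep M X Y -> (X < M.+1)%N /\ (Y < M.+1)%N.
Proof.
case/andP => _ /eqP <-; rewrite !ltnS -!mulnn.
by have := leq_pmulr X (n := X); have := leq_pmulr Y (n := Y); case: X; case: Y; lia.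
Qed.

Lemma rep_dvd p M X Y : prime p -> (p = 1 %[mod 24])%N -> (p %| M)%N ->
  is_rep M X Y -> (p %| X)%N = (p %| Y)%N.
Proof.
move=> pp p24 pM /andP[_ /eqP E].
have ndvd k : (0 < k < 25)%N -> (p %| k)%N = false.
  by move=> k25; have := ndvd_nat pp p24 k25; rewrite dvdzE => /negPf.
have <- : (p %| 16 * X ^ 2)%N = (p %| X)%N by rewrite Euclid_dvdM // ndvd // Euclid_dvdX // andbT.
have <- : (p %| 3 * Y ^ 2)%N = (p %| Y)%N by rewrite Euclid_dvdM // ndvd // Euclid_dvdX // andbT.
rewrite -E in pM; apply/idP/idP => d; first by rewrite -(dvdn_addr _ d).
by rewrite -(dvdn_addl _ d).
Qed.

Section PrimitiveReps.
Variables (p e L : nat) (u w : int).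
Hypotheses (pp : prime p) (p24 : (p = 1 %[mod 24])%N).
Let Q : int := p%:Z ^+ e.+1.
Hypotheses (uw : u ^+ 2 + 48 * w ^+ 2 = Q)
  (up : ~~ (p%:Z %| u)%Z) (wp : ~~ (p%:Z %| w)%Z).
Hypotheses (pL : ~~ (p %| L)%N).
Let M := (p ^ e.+1 * L)%N.
Hypothesis M24 : (M = 19 %[mod 24])%N.
Local Notation swap := (swap u w).

Lemma uw_sign s : s = w \/ s = - w -> u ^+ 2 + 48 * s ^+ 2 = Q /\ ~~ (p%:Z %| s)%Z.
Proof. by case=> ->; rewrite ?sqrrN ?rpredN. Qed.

Let pQ : (p%:Z %| Q)%Z.
Proof. by rewrite /Q exprS dvdz_mulr. Qed.

Lemma Q_neq0 : Q != 0.
Proof. by rewrite expf_neq0 //; have := prime_gt0 pp; lia. Qed.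

Lemma swap_is_rep X Y X' Y' : is_rep M X Y -> swap X Y X' Y' -> is_rep M X' Y'.
Proof.
by move=> /andP[oX /eqP E] sw; rewrite /is_rep -(swap_odd sw) oX -(swap_norm sw) E eqxx.
Qed.

Lemma swap_quotient X Y s g h : is_rep M X Y -> s = w \/ s = - w ->
  X%:Z = u * g - 3 * s * h -> Y%:Z = u * h + 16 * s * g ->
  L%:Z = 16 * g ^+ 2 + 3 * h ^+ 2.
Proof.
case/andP => _ /eqP E /uw_sign[us _] XE YE; apply: (mulfI Q_neq0).
have -> : Q * L%:Z = M%:Z by rewrite /M /Q PoszM -!natz natrX.
transitivity (16 * X%:Z ^+ 2 + 3 * Y%:Z ^+ 2); first by rewrite -E; clear; lia.
by rewrite XE YE -us; ring.
Qed.

(** If p divided Pi * conj beta, then conj pi, which does not divide Pi, would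
    divide conj beta, and p would divide the norm L of beta. *)
Lemma swap_ndvd X Y X' Y' : is_rep M X Y -> swap X Y X' Y' -> ~~ (p %| X')%N.
Proof.
move=> rXY sw; have rXY' := swap_is_rep rXY sw.
case: sw => s [g [h [sw XE YE X'E Y'E]]].
have LE := swap_quotient rXY sw XE YE.
have pM : (p %| M)%N by rewrite /M expnS -mulnA dvdn_mulr.
apply/negP => pX; have pY := pX; rewrite (rep_dvd pp p24 pM rXY') in pY.
have pA : (p%:Z %| u * g + 3 * s * h)%Z by rewrite dvdzE -X'E.
have pB : (p%:Z %| u * h - 16 * s * g)%Z by rewrite dvdzE -Y'E.
have : (p%:Z %| u * L%:Z)%Z.
  have -> : u * L%:Z = 16 * g * (u * g + 3 * s * h) + 3 * h * (u * h - 16 * s * g).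
    by rewrite LE; ring.
  by rewrite rpredD // dvdz_mull.
by rewrite Euclid_dvdzM // (negPf up) dvdzE /= (negPf pL).
Qed.

(** If both Pi and conj Pi divided alpha, p would divide 32 s X. *)
Lemma swap_functional X Y X1 Y1 X2 Y2 : ~~ (p %| X)%N ->
  swap X Y X1 Y1 -> swap X Y X2 Y2 -> X1 = X2 /\ Y1 = Y2.
Proof.
move=> pX [s [g [h [sw XE YE -> ->]]]] [s' [g' [h' [sw' XE' YE' -> ->]]]].
have [us ps] := uw_sign sw; have [us' _] := uw_sign sw'.
have hE : u * Y%:Z - 16 * s * X%:Z = Q * h by rewrite XE YE -us; ring.
have gE : u * X%:Z + 3 * s * Y%:Z = Q * g by rewrite XE YE -us; ring.
have hE' : u * Y%:Z - 16 * s' * X%:Z = Q * h' by rewrite XE' YE' -us'; ring.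
have gE' : u * X%:Z + 3 * s' * Y%:Z = Q * g' by rewrite XE' YE' -us'; ring.
have [ss|ss] : s' = s \/ s' = - s.
  by case: sw => ->; case: sw' => ->; rewrite ?opprK; [left|right|right|left].
  rewrite ss in hE' gE' *.
  have -> : g' = g by apply: (mulfI Q_neq0); rewrite -gE -gE'.
  have -> : h' = h by apply: (mulfI Q_neq0); rewrite -hE -hE'.
  by [].
have : (p%:Z %| 16%:Z * 2%:Z * (s * X%:Z))%Z.
  have -> : 16%:Z * 2%:Z * (s * X%:Z) = Q * (h' - h).
    by rewrite mulrBr -hE -hE' ss; ring.
  exact: dvdz_mulr.
rewrite !Euclid_dvdzM // (negPf ps) [(_ %| X%:Z)%Z]dvdzE /= (negPf pX).
by rewrite !(negPf (ndvd_nat pp p24 _)).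
Qed.

(** A fixed point would have g = 0 or h = 0, making X divisible by 3 or Y even,
    against M = 19 modulo 24. *)
Lemma swap_irrefl X Y : is_rep M X Y -> ~ swap X Y X Y.
Proof.
case/andP => _ /eqP E [s [g [h [sw XE YE X'E Y'E]]]].
have [_ ps] := uw_sign sw.
have s0 : s != 0 by apply: contraNneq ps => ->; rewrite dvdz0.
have u0 : u != 0 by apply: contraNneq up => ->; rewrite dvdz0.
have : X%:Z ^+ 2 = (u * g + 3 * s * h) ^+ 2 by rewrite X'E absz_sqr.
move/eqP; rewrite XE -subr_eq0.
have -> : (u * g - 3 * s * h) ^+ 2 - (u * g + 3 * s * h) ^+ 2 = - 12%:Z * u * g * s * h by ring.
rewrite !mulf_eq0 (negPf u0) (negPf s0) !orbF /= => /orP[] /eqP z0; move: E M24.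
  have : X%:Z = 3 * - (s * h) by rewrite XE z0; ring.
  by move: (s * h) M => c m; clear; lia.
have : Y%:Z = 2 * (8 * s * g) by rewrite YE z0; ring.
by move: (8 * s * g) M => c m; clear; lia.
Qed.

Lemma coprime_dvd_one (D1 D2 : int) : ~~ (p%:Z %| D1)%Z -> (Q %| D1 * D2)%Z -> (Q %| D2)%Z.
Proof.
move=> pD; rewrite Gauss_dvdzr // /Q coprimezE abszX coprimeXl //.
by rewrite prime_coprime // -[X in ~~ X]/(p%:Z %| D1)%Z.
Qed.

(** Let D s be the coefficient of sqrt(-3) in alpha * conj Pi. The norm Q of Pi
    divides 3 D(w) D(-w), and p cannot divide both D(w) and D(-w), so Q divides
    one of them; then it also divides the other coordinate of alpha * conj Pi. *)
Lemma swap_total X Y : is_rep M X Y -> ~~ (p %| X)%N -> exists X' Y', swap X Y X' Y'.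
Proof.
move=> rXY pX; have /andP[_ /eqP E] := rXY.
have ME : 16 * X%:Z ^+ 2 + 3 * Y%:Z ^+ 2 = Q * L%:Z.
  have -> : Q * L%:Z = M%:Z by rewrite /M /Q PoszM -!natz natrX.
  by rewrite -E; clear; lia.
pose D s : int := u * Y%:Z - 16 * s * X%:Z.
have DD : (Q %| D w * D (- w))%Z.
  apply: (@coprime_dvd_one 3%:Z); first exact: (ndvd_nat pp p24).
  have -> : 3%:Z * (D w * D (- w)) = Q * (u ^+ 2 * L%:Z - 16 * X%:Z ^+ 2).
    transitivity (u ^+ 2 * (Q * L%:Z) - 16 * X%:Z ^+ 2 * Q); last by ring.
    by rewrite -ME -uw /D; ring.
  exact: dvdz_mulr.
have [s sw sD] : exists2 s, s = w \/ s = - w & (Q %| D s)%Z.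
  have [pD|pD] := boolP (p%:Z %| D w)%Z; last first.
    by exists (- w); [right|exact: coprime_dvd_one pD DD].
  exists w; [by left|]; rewrite mulrC in DD; apply: coprime_dvd_one DD.
  apply/negP => pD'; have := rpredB pD' pD.
  have -> : D (- w) - D w = 16%:Z * 2%:Z * (w * X%:Z) by rewrite /D; ring.
  rewrite !Euclid_dvdzM // (negPf wp) [(_ %| X%:Z)%Z]dvdzE /= (negPf pX).
  by rewrite !(negPf (ndvd_nat pp p24 _)).
have [us ps] := uw_sign sw.
have /dvdzP[h hE] := sD.
have /dvdzP[g gE] : (Q %| u * X%:Z + 3 * s * Y%:Z)%Z.
  apply: coprime_dvd_one up _.
  have -> : u * (u * X%:Z + 3 * s * Y%:Z) = Q * (X%:Z + 3 * s * h).
    transitivity (Q * X%:Z + 3 * s * (h * Q)); last by ring.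
    by rewrite -hE -us /D; ring.
  exact: dvdz_mulr.
exists (absz (u * g + 3 * s * h)%R), (absz (u * h - 16 * s * g)%R), s, g, h.
split=> //; apply: (mulfI Q_neq0).
  transitivity (u * (g * Q) - 3 * s * (h * Q)); last by ring.
  by rewrite -hE -gE -us /D; ring.
transitivity (u * (h * Q) + 16 * s * (g * Q)); last by ring.
by rewrite -hE -gE -us /D; ring.
Qed.

Lemma even_primitive_reps : ~~ odd #|[set z in reps M | ~~ (p %| z.1)%N]|.
Proof.
apply: (@even_matching _ _ (fun z z' : 'I_M.+1 * 'I_M.+1 => swap z.1 z.2 z'.1 z'.2)).
- move=> [X Y]; rewrite !inE /= => /andP[rXY pX].
  have [X' [Y' sw]] := swap_total rXY pX.
  have rXY' := swap_is_rep rXY sw.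
  have [X'M Y'M] := is_rep_bound rXY'.
  by exists (Ordinal X'M, Ordinal Y'M) => //; rewrite !inE /= rXY' (swap_ndvd rXY sw).
- by move=> [X Y] [X' Y'] _ _ /=; apply: swap_sym.
- move=> [X Y] [X1 Y1] [X2 Y2]; rewrite !inE /= => /andP[_ pX] _ _ s1 s2.
  have [E1 E2] := swap_functional pX s1 s2.
  by congr (_, _); apply: val_inj.
by move=> [X Y]; rewrite !inE /= => /andP[rXY _]; apply: swap_irrefl.
Qed.

End PrimitiveReps.

Lemma card_nonprimitive_reps p L M : prime p -> odd p -> M = (p ^ 2 * L)%N ->
  #|[set z in reps M | (p %| z.1) && (p %| z.2)]%N| = #|reps L|.
Proof.
move=> pp oddp ME; have p0 := prime_gt0 pp.
have repE X Y : is_rep M (p * X) (p * Y) = is_rep L X Y.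
  rewrite /is_rep ME oddM oddp /=; congr (_ && _).
  have -> : (16 * (p * X) ^ 2 + 3 * (p * Y) ^ 2 = p ^ 2 * (16 * X ^ 2 + 3 * Y ^ 2))%N.
    by rewrite !expnMn; ring.
  by rewrite eqn_pmul2l ?expn_gt0 ?p0.
have bound X Y : is_rep L X Y -> (p * X < M.+1)%N /\ (p * Y < M.+1)%N.
  by rewrite -repE; apply: is_rep_bound.
pose f (z : 'I_L.+1 * 'I_L.+1) : 'I_M.+1 * 'I_M.+1 := (inord (p * z.1), inord (p * z.2)).
have fE z : z \in reps L -> ((f z).1 = p * z.1 :> nat)%N /\ ((f z).2 = p * z.2 :> nat)%N.
  by rewrite inE => /bound[b1 b2]; rewrite /f /= !inordK.
rewrite -(@card_in_imset _ _ f (reps L)).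
  apply: eq_card => z; rewrite !inE; apply/idP/imsetP; last first.
    move=> [t tL ->]; have [-> ->] := fE t tL.
    by rewrite inE in tL; rewrite repE tL !dvdn_mulr.
  case: z => [X Y] /= /and3P[rXY /dvdnP[x xE] /dvdnP[y yE]].
  move: (rXY); rewrite xE yE ![(_ * p)%N]mulnC repE => r.
  have [xL yL] := is_rep_bound r.
  exists (Ordinal xL, Ordinal yL); first by rewrite inE.
  by congr (_, _); apply: val_inj; rewrite /= inordK ?[(p * _)%N]mulnC -?xE -?yE.
move=> [X Y] [X' Y'] /fE/= [e1 e2] /fE/= [e1' e2'] [E1 E2].
have /eqP : (p * X = p * X')%N by rewrite -e1 -e1' E1.
have /eqP : (p * Y = p * Y')%N by rewrite -e2 -e2' E2.
by rewrite !eqn_pmul2l // => /eqP/val_inj -> /eqP/val_inj ->.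
Qed.

(** Descent on M: the solutions not divisible by p are even in number, and the
    others come from M / p^2; when p divides M only once there are no others. *)
Lemma even_reps p M : prime p -> (p = 1 %[mod 24])%N -> (M = 19 %[mod 24])%N ->
  odd (logn p M) -> ~~ odd #|reps M|.
Proof.
move=> pp p24; have p1 := prime_gt1 pp.
have [n] := ubnP M; elim: n M => // n IH M; rewrite ltnS => Mn M24 olog.
have M0 : (0 < M)%N by move: M24; clear; lia.
have [L coL ME] := pfactor_coprime pp M0.
move: ME olog; case: (logn p M) => // e ME olog; rewrite mulnC in ME.
have pL : ~~ (p %| L)%N by rewrite -prime_coprime.
have [u [w [uw up wp]]] := prime_power_x2_48y2 e pp p24.
have := @even_primitive_reps p e L u w pp p24 uw up wp pL; rewrite -ME => /(_ M24) prim.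
have pM : (p %| M)%N by rewrite ME expnS -mulnA dvdn_mulr.
pose B := [set z : 'I_M.+1 * 'I_M.+1 | (p %| z.1)%N].
have dvd2 X Y : is_rep M X Y -> (p %| X)%N -> (p %| Y)%N.
  by move=> /(rep_dvd pp p24 pM) <-.
rewrite -(cardsID B (reps M)) oddD.
have -> : reps M :\: B = [set z in reps M | ~~ (p %| z.1)%N].
  by apply/setP => z; rewrite !inE andbC.
rewrite (negPf prim) addbF.
have -> : reps M :&: B = [set z in reps M | (p %| z.1) && (p %| z.2)]%N.
  apply/setP => z; rewrite !inE; case rz: is_rep => //=.
  by case pz: (p %| z.1)%N => //=; rewrite (dvd2 _ _ rz).
have oddp : odd p by move: p24; clear; lia.
(* If p divides M only once, p divides no solution; p-adic valuation 2 is excluded. *)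
case: e ME olog {uw prim pM dvd2} => [|[|e]] ME olog //.
  rewrite (_ : [set z in _ | _] = set0) ?cards0 //.
  apply/setP => z; rewrite !inE; apply/and3P => -[/andP[_ /eqP E] /dvdnP[x xE] /dvdnP[y yE]].
  have : (p ^ 2 %| p ^ 1 * L)%N.
    rewrite -ME -E xE yE.
    have -> : (16 * (x * p) ^ 2 + 3 * (y * p) ^ 2 = (16 * x ^ 2 + 3 * y ^ 2) * p ^ 2)%N.
      by rewrite !expnMn; ring.
    exact: dvdn_mull.
  by rewrite expn1 -mulnn dvdn_pmul2l ?prime_gt0 // (negPf pL).
have M2 : M = (p ^ 2 * (p ^ e.+1 * L))%N by rewrite ME mulnA -expnD.
rewrite (card_nonprimitive_reps pp oddp M2); move: M2; set L' := (p ^ e.+1 * L)%N => M2.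
apply: IH.
- rewrite (leq_trans _ Mn) // M2 -[X in (X < _)%N]mul1n ltn_pmul2r; last first.
    by move: M0; rewrite M2 muln_gt0 => /andP[].
  by rewrite -mulnn; move: p1; clear; nia.
- by rewrite -M24 M2 -modnMml -modnXm p24 mul1n.
have L0 : (0 < L)%N by rewrite lt0n; apply: contraNneq pL => ->; rewrite dvdn0.
rewrite lognM ?expn_gt0 ?(prime_gt0 pp) // pfactorK // logn_coprime // addn0.
by move: olog; rewrite /= negbK.
Qed.

(** * The congruence *)

Theorem theorem1p2 (k n : nat) (p : 'I_k.+1 -> nat)
  (p_prime : forall i, prime (p i))
  (p_mod24 : forall i, (p i = 1 %[mod 24])%N)
  (p_EObar : forall i,
     (EObar ((19 * (p i)%:Z - 1) %/ 3)%Z = 0 %[mod 8])%N)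
  (j : int) (j_mod : (j <> 0 %[mod (p ord_max)%:Z])%Z) :
  let P : int := \prod_(i < k) (p (widen_ord (leqnSn k) i))%:Z ^+ 2 in
  let q : int := (p ord_max)%:Z in
  (EObar (8 * (P * q ^+ 2) * n%:Z
          + ((P * q * (24 * j + 19 * q) - 1) %/ 3)%Z) = 0 %[mod 8])%N.
Proof.
move=> P q.
pose K := (\prod_(i < k) p (widen_ord (leqnSn k) i))%N.
have PE : P = (K ^ 2)%N%:Z.
  by rewrite /P /K -natz natrX natr_prod -prodrXl; apply: eq_bigr => i _; rewrite natz.
have q24 := p_mod24 ord_max; have qp := p_prime ord_max.
have K24 : (K = 1 %[mod 24])%N.
  rewrite /K; elim/big_ind: _ => // a b a1 b1.
  by rewrite -modnMml a1 modnMml mul1n.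
set r := p ord_max in q q24 qp j_mod *.
(* If a is the argument of EObar in the conclusion, then 3 a + 1 = P q t. *)
pose t : int := 24 * (q * n%:Z + j) + 19 * q.
have ME : exists x : int, P * q * t = 24 * x + 19.
  have [a aE] : exists a, (K ^ 2 * r ^ 2)%N = (24 * a + 1)%N.
    exists ((K ^ 2 * r ^ 2) %/ 24)%N; rewrite {1}(divn_eq (K ^ 2 * r ^ 2) 24) mulnC.
    by rewrite -modnMm -modnXm K24 modnXm -(modnXm _ _ r) q24.
  exists (P * q * (q * n%:Z + j) + 19 * a%:Z).
  have : P * q ^+ 2 = 24 * a%:Z + 1 by rewrite PE /q; lia.
  rewrite /t => E; transitivity (24 * (P * q * (q * n%:Z + j)) + 19 * (P * q ^+ 2)); first by ring.
  by rewrite E; ring.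
case: ME => x xE.
have argE : 8 * (P * q ^+ 2) * n%:Z + ((P * q * (24 * j + 19 * q) - 1) %/ 3)%Z = 8 * x + 6.
  have : P * q * (24 * j + 19 * q) - 1 = (8 * x + 6 - 8 * (P * q ^+ 2) * n%:Z) * 3.
    transitivity (P * q * t - 24 * (P * q ^+ 2) * n%:Z - 1); first by rewrite /t; ring.
    by rewrite xE; ring.
  by move=> ->; rewrite mulzK //; ring.
(* At a negative argument EObar is zero. *)
rewrite argE; case: x xE argE => [m|m] xE _; last by rewrite (_ : 8 * Negz m + 6 = Negz (8 * m + 1)) //; lia.
have -> : 8 * m%:Z + 6 = (8 * m + 6)%N%:Z by lia.
rewrite /= mod0n; apply/eqP; apply: EObar_reps.
apply: (even_reps qp q24).
  by rewrite -modnDml modnMr.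
have PqE : P * q = (K ^ 2 * r)%N%:Z by rewrite PE PoszM.
have [T TE] : exists T : nat, t = T%:Z.
  case: (t) xE => [T|T]; first by exists T.
  by rewrite PqE NegzE => xE; exfalso; move: xE; rewrite mulrN -PoszM; lia.
have ME : (24 * m + 19 = K ^ 2 * r * T)%N.
  by apply/eqP; rewrite -eqz_nat PoszM -PqE -TE xE; lia.
have rT : ~~ (r %| T)%N.
  apply/negP => rT; apply: j_mod; apply/eqP; rewrite eqz_mod_dvd subr0.
  have : (r%:Z %| 24%:Z * j)%Z.
    have -> : 24%:Z * j = T%:Z - q * (24 * n%:Z + 19) by rewrite -TE /t; ring.
    by rewrite rpredB ?dvdz_mulr // dvdzE.
  by rewrite Euclid_dvdzM // (negPf (ndvd_nat qp q24 _)).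
have : (0 < K ^ 2 * r * T)%N by rewrite -ME addnS.
rewrite ME muln_gt0 => /andP[Kr0 T0]; have := Kr0; rewrite muln_gt0 => /andP[K0 r0].
rewrite (lognM _ Kr0 T0) (lognM _ K0 r0) lognX (logn_prime _ qp) eqxx.
by rewrite (@logn_coprime r T) ?prime_coprime // addn0 addn1 /= oddM.
Qed.
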